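(* If $\mathbf{X}\sim CFUSN_{n,m}(\boldsymbol{\mu},\boldsymbol{\Sigma},\boldsymbol{\Delta})$, then the entropy of $\mathbf{X}$ is $$H_{CFUSN_{n,m}(\boldsymbol{\mu},\boldsymbol{\Sigma},\boldsymbol{\Delta})}=H_{N_n(\mathbf{0},\mathbf{I}_n)}+\frac12\ln|\boldsymbol{\Sigma}|+\frac1\pi\left[\mathbf{1}_m'\boldsymbol{\Delta}'\boldsymbol{\Delta}\mathbf{1}_m-\mathrm{tr}(\boldsymbol{\Delta}\boldsymbol{\Delta}')\right]-E_{\mathbf{X}_0}\left[\ln\left(2^m\Phi_m(\boldsymbol{\Delta}'\mathbf{X}_0\mid\boldsymbol{\Delta}^* )\right)\right],$$ where $\mathbf{X}_0\sim CFUSN_{n,m}(\boldsymbol{\Delta})$, $\boldsymbol{\Delta}^*=\mathbf{I}_m-\boldsymbol{\Delta}'\boldsymbol{\Delta}$, and $H_{N_n(\mathbf{0},\mathbf{I}_n)}=\frac n2(1+\ln(2\pi))$.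
   Context: The (Shannon, differential) entropy of a continuous random vector $\mathbf{Z}$ with density $f_{\mathbf{Z}}$ is $H_{\mathbf{Z}}=-E[\ln f_{\mathbf{Z}}(\mathbf{Z})]$; $H_D$ denotes the entropy of a random vector with distribution $D$. Notation: a prime denotes transpose; $|\mathbf{A}|=\det\mathbf{A}$; $\mathbf{1}_m$ is the $m\times1$ vector of ones; $\phi_n$ is the density of $N_n(\mathbf{0},\mathbf{I}_n)$; $\Phi_m(\cdot\mid\mathbf{S})$ is the cumulative distribution function of $N_m(\mathbf{0},\mathbf{S})$; $\|\cdot\|$ is the Euclidean norm. Canonical fundamental skew-normal distribution: let $n,m\ge1$ and let $\boldsymbol{\Delta}$ be a real $n\times m$ matrix (skewness matrix) with $\|\boldsymbol{\Delta}\mathbf{a}\|<1$ for all unit vectors $\mathbf{a}\in\mathbb{R}^m$ (equivalently, $\mathbf{I}_m-\boldsymbol{\Delta}'\boldsymbol{\Delta}$ is positive definite). $\mathbf{Z}\sim CFUSN_{n,m}(\boldsymbol{\Delta})$ means that $\mathbf{Z}$ has density $$f_{\mathbf{Z}}(\mathbf{z})=2^m\phi_n(\mathbf{z})\,\Phi_m(\boldsymbol{\Delta}'\mathbf{z}\mid\mathbf{I}_m-\boldsymbol{\Delta}'\boldsymbol{\Delta}),\quad\mathbf{z}\in\mathbb{R}^n.$$ Location-scale version: for $\boldsymbol{\mu}\in\mathbb{R}^n$ and a positive definite $n\times n$ matrix $\boldsymbol{\Sigma}$ with symmetric positive definite square root $\boldsymbol{\Sigma}^{1/2}$, $\mathbf{W}\sim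 CFUSN_{n,m}(\boldsymbol{\mu},\boldsymbol{\Sigma},\boldsymbol{\Delta})$ means that $\mathbf{W}=\boldsymbol{\mu}+\boldsymbol{\Sigma}^{1/2}\mathbf{Z}$ with $\mathbf{Z}\sim CFUSN_{n,m}(\boldsymbol{\Delta})$; equivalently, $\mathbf{W}$ has density $$f_{\mathbf{W}}(\mathbf{w})=2^m|\boldsymbol{\Sigma}|^{-1/2}\phi_n(\boldsymbol{\Sigma}^{-1/2}(\mathbf{w}-\boldsymbol{\mu}))\,\Phi_m(\boldsymbol{\Delta}'\boldsymbol{\Sigma}^{-1/2}(\mathbf{w}-\boldsymbol{\mu})\mid\mathbf{I}_m-\boldsymbol{\Delta}'\boldsymbol{\Delta}),\quad\mathbf{w}\in\mathbb{R}^n.$$ *)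

(* Defs.v *)
From HB Require Import structures.
From mathcomp Require Import all_boot all_order all_algebra.
From mathcomp Require Import all_classical all_reals all_analysis.

Set Implicit Arguments.
Unset Strict Implicit.
Unset Printing Implicit Defensive.

Import Order.TTheory GRing.Theory Num.Theory.
Import numFieldNormedType.Exports.

Local Open Scope classical_set_scope.
Local Open Scope ring_scope.

(* The measurable space R^n: tuples carry the product sigma-algebra (that of
   the coordinate projections) and [colv] turns them into the column vectors
   of the matrix library. *)
Notation Rvec R n := (n.-tuple (measurableTypeR R)).

Definition colv (R : realType) (n : nat) (x : Rvec R n) : 'cV[R]_n :=
  \col_i (tnth x i : R).

(* Lebesgue measure on R^n, by induction on n: the point mass on R^0, and on
   R^(n+1) the image of the product of the Lebesgue measures of R and R^n under
   (x, t) |-> x :: t. *)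
Section lebesgue_measure_vec.
Context (R : realType).
Local Open Scope ereal_scope.

Definition vcons (n : nat) (p : measurableTypeR R * Rvec R n) : Rvec R n.+1 :=
  [tuple of p.1 :: p.2].

Lemma measurable_vcons n : measurable_fun [set: _] (@vcons n).
Proof. exact: measurable_cons. Qed.

Section step.
Variables (n : nat) (mu : {sigma_finite_measure set (Rvec R n) -> \bar R}).

Definition lebesgue_vec_step : set (Rvec R n.+1) -> \bar R :=
  pushforward ((@lebesgue_measure R) \x mu) (@vcons n).

Let nu : {measure set (Rvec R n.+1) -> \bar R} :=
  measure_function_pushforward__canonical__measure_function_Measure
    ((@lebesgue_measure R) \x mu) (@measurable_vcons n).

Let step0 : lebesgue_vec_step set0 = 0.
Proof. exact: (measure0 nu). Qed.

Let step_ge0 A : 0 <= lebesgue_vec_step A.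
Proof. exact: (measure_ge0 nu). Qed.

Let step_sigma_additive : semi_sigma_additive lebesgue_vec_step.
Proof. exact: (@measure_semi_sigma_additive _ _ _ nu). Qed.

HB.instance Definition _ := isMeasure.Build _ _ _ lebesgue_vec_step
  step0 step_ge0 step_sigma_additive.

Let step_sigma_finite : sigma_finite [set: Rvec R n.+1] lebesgue_vec_step.
Proof.
have /sigma_finiteP[F [TF ndF Foo]] := sigma_finiteT (@lebesgue_measure R).
have /sigma_finiteP[G [TG ndG Goo]] := sigma_finiteT mu.
pose hd (t : Rvec R n.+1) : measurableTypeR R := tnth t ord0.
pose tl (t : Rvec R n.+1) : Rvec R n := [tuple of behead t].
have mhd : measurable_fun [set: _] hd by exact: measurable_tnth.
have mtl : measurable_fun [set: _] tl by exact: measurable_behead.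
exists (fun i => hd @^-1` F i `&` tl @^-1` G i).
  apply/seteqP; split => // t _.
  have : [set: measurableTypeR R] (hd t) by [].
  have : [set: Rvec R n] (tl t) by [].
  rewrite TF TG => -[k _ Gk] [j _ Fj]; exists (maxn j k) => //; split => /=.
    by move: Fj; exact/subsetPset/ndF/leq_maxl.
  by move: Gk; exact/subsetPset/ndG/leq_maxr.
move=> i; have [mF Fi] := Foo i; have [mG Gi] := Goo i; split.
  by apply: measurableI; rewrite -[X in measurable X]setTI; [exact: mhd|exact: mtl].
rewrite /lebesgue_vec_step /pushforward (_ : _ @^-1` _ = F i `*` G i).
  by rewrite product_measure1E// lte_mul_pinfty// ge0_fin_numE.
have tlK p : tl (vcons p) = p.2 by exact/val_inj.
by apply/seteqP; split => p /=; rewrite tlK.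
Qed.

HB.instance Definition _ := Measure_isSigmaFinite.Build _ _ _
  lebesgue_vec_step step_sigma_finite.
End step.

Fixpoint lebesgue_vec (n : nat) :
    {sigma_finite_measure set (Rvec R n) -> \bar R} :=
  match n with
  | 0%N => \d_([tuple] : Rvec R 0)
  | k.+1 => lebesgue_vec_step (lebesgue_vec k)
  end.

End lebesgue_measure_vec.
Arguments lebesgue_vec R n : clear implicits.

Definition enorm (R : realType) (n : nat) (x : 'cV[R]_n) : R :=
  Num.sqrt (\sum_i x i 0 ^+ 2).

Definition posdef (R : realType) (n : nat) (S : 'M[R]_n) : Prop :=
  S^T = S /\ forall x : 'cV[R]_n, x != 0 -> 0 < (x^T *m S *m x) 0 0.

(* Density of N_m(0, S), for S positive definite. *)
Definition mvnormal_pdf (R : realType) (m : nat) (S : 'M[R]_m) (x : 'cV[R]_m) : R :=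
  (Num.sqrt ((2 * pi) ^+ m * \det S))^-1
  * expR (- (x^T *m invmx S *m x) 0 0 / 2).

Definition phi (R : realType) (n : nat) (x : 'cV[R]_n) : R :=
  mvnormal_pdf 1%:M x.

Definition Phi (R : realType) (m : nat) (x : 'cV[R]_m) (S : 'M[R]_m) : R :=
  \int[lebesgue_vec R m]_(y in [set y | forall i, colv y i 0 <= x i 0])
    mvnormal_pdf S (colv y).

Definition has_density (R : realType) (n : nat) (d : measure_display)
    (T : measurableType d) (P : probability T R) (X : {RV P >-> Rvec R n})
    (f : Rvec R n -> R) : Prop :=
  [/\ measurable_fun [set: Rvec R n] f,
      forall x, 0 <= f x &
      forall A, measurable A ->
        distribution P X A = (\int[lebesgue_vec R n]_(x in A) (f x)%:E)%E].

(* Densities are unique only almost everywhere, so [h] is required to be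
   -E[ln f(X)] for every version f of the density, and the expectation to be
   that of an integrable variable.  The convention [ln 0 = 0] is harmless:
   f(X) > 0 almost surely. *)
Definition is_entropy (R : realType) (n : nat) (d : measure_display)
    (T : measurableType d) (P : probability T R) (X : {RV P >-> Rvec R n})
    (h : R) : Prop :=
  (exists f, has_density X f) /\
  forall f, has_density X f ->
    P.-integrable [set: T] (EFin \o (fun w => ln (f (X w)))) /\
    (- 'E_P[fun w => ln (f (X w))] = h%:E)%E.

Definition is_std_normal (R : realType) (n : nat) (d : measure_display)
    (T : measurableType d) (P : probability T R) (Y : {RV P >-> Rvec R n}) : Prop :=
  has_density Y (fun y => phi (colv y)).

Definition skewness_matrix (R : realType) (n m : nat) (Delta : 'M[R]_(n, m)) : Prop :=
  forall a : 'cV[R]_m, enorm a = 1 -> enorm (Delta *m a) < 1.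

Definition cfusn_pdf (R : realType) (n m : nat) (Delta : 'M[R]_(n, m))
    (z : 'cV[R]_n) : R :=
  2 ^+ m * phi z * Phi (Delta^T *m z) (1%:M - Delta^T *m Delta).

Definition is_cfusn (R : realType) (n m : nat) (d : measure_display)
    (T : measurableType d) (P : probability T R) (Z : {RV P >-> Rvec R n})
    (Delta : 'M[R]_(n, m)) : Prop :=
  has_density Z (fun z => cfusn_pdf Delta (colv z)).

(* X = mu + Sigma^(1/2) Z with Z ~ CFUSN(Delta).  [S] is Sigma^(1/2), the unique
   symmetric positive definite square root of Sigma; as it is invertible, Z is
   determined by X and lives on the same probability space. *)
Definition is_cfusn_ls (R : realType) (n m : nat) (d : measure_display)
    (T : measurableType d) (P : probability T R) (X : {RV P >-> Rvec R n})
    (mu : 'cV[R]_n) (Sigma : 'M[R]_n) (Delta : 'M[R]_(n, m)) : Prop :=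
  exists (S : 'M[R]_n) (Z : {RV P >-> Rvec R n}),
    [/\ posdef S, S *m S = Sigma, is_cfusn Z Delta &
        forall w, colv (X w) = mu + S *m colv (Z w)].

(* Main.v *)
Require Import Defs.
From mathcomp Require Import all_boot all_order all_algebra.
From mathcomp Require Import all_classical all_reals all_analysis.
From mathcomp Require Import measurable_realfun ring lra.

Set Implicit Arguments.
Unset Strict Implicit.
Unset Printing Implicit Defensive.

Import Order.TTheory GRing.Theory Num.Theory.
Import numFieldNormedType.Exports.

Local Open Scope classical_set_scope.
Local Open Scope ring_scope.

(** If Z has density [f z = phi z * (2 ^ m * Phi (Delta^T z))], then
    [- ln f Z = n / 2 * ln (2 pi) + |Z| ^ 2 / 2 - ln (2 ^ m * Phi (Delta^T Z))]
    wherever [f Z > 0], that is, almost surely.  Passing from Z to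
    [X = mu + Sigma^(1/2) Z] divides the density by [det Sigma^(1/2)] and so adds
    [ln (det Sigma) / 2].  Everything thus rests on the second moment
    [E |Z| ^ 2 = n + 2 / pi * (|Delta 1| ^ 2 - tr (Delta Delta^T))]
    ([has_integral_sqn_cfusn]) and on the integrability of the logarithm of the
    skewing factor ([integrable_ln_skewing]).

    For the second moment, write [Phi (Delta^T z)] as the integral over the
    orthant [u >= 0] of the normal density of covariance
    [S = 1 - Delta^T Delta] at [Delta^T z - u].  Completing the square in z turns
    the joint density [phi z * mvnormal_pdf S (Delta^T z - u)] into [phi u] times
    the normal density in z of mean [Delta u] and covariance
    [1 - Delta Delta^T].  After Tonelli and a linear change of variables this is
    the representation [Z = Delta U + L V] ([ge0_integral_cfusn]), where U has
    independent half-normal coordinates, V is standard normal and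
    [L L^T = 1 - Delta Delta^T].  Both laws are products of one-dimensional laws
    of second moment 1, of mean c equal to [sqrt (2 / pi)] and to 0, for which
    [E |v + L V| ^ 2 = |v + c L 1| ^ 2 + (1 - c ^ 2) tr (L L^T)]
    ([has_integral_sqn_affine]).

    The skewing factor [t = 2 ^ m * Phi] is bounded, and [|ln t| * t <= 1 + t ^ 2],
    so that integrating its logarithm against [phi z * t] is harmless.

    The linear changes of variables that occur are given by [-1], by positive
    definite matrices or by their Cholesky factors.  A triangular matrix acts on one
    coordinate at a time, which reduces the Jacobian formula on R^n to its
    one-dimensional case and Tonelli. *)

(** * Affine changes of variables on R^n *)
Section lebesgue_vec_integral.
Context (R : realType).
Local Open Scope ereal_scope.

Lemma ge0_integral_lebesgue_vecS n (f : Rvec R n.+1 -> \bar R) :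
  measurable_fun [set: Rvec R n.+1] f -> (forall x, 0 <= f x) ->
  \int[lebesgue_vec R n.+1]_x f x =
  \int[@lebesgue_measure R]_t \int[lebesgue_vec R n]_x f (vcons (t, x)).
Proof.
move=> mf f0.
rewrite [LHS](@ge0_integral_pushforward _ _ _ _ _ _ (@measurable_vcons R n))//.
rewrite preimage_setT (fubini_tonelli1 (fun z => f (vcons z)))//.
apply: (measurableT_comp mf); exact: measurable_vcons.
Qed.

Lemma ge0_integral_lebesgue_vecS_swap n (f : Rvec R n.+1 -> \bar R) :
  measurable_fun [set: Rvec R n.+1] f -> (forall x, 0 <= f x) ->
  \int[lebesgue_vec R n.+1]_x f x =
  \int[lebesgue_vec R n]_x \int[@lebesgue_measure R]_t f (vcons (t, x)).
Proof.
move=> mf f0; rewrite ge0_integral_lebesgue_vecS//.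
rewrite (fubini_tonelli (fun z => f (vcons z)))//.
apply: (measurableT_comp mf); exact: measurable_vcons.
Qed.

End lebesgue_vec_integral.

Section affine.
Context (R : realType).

Definition affine m n (c : 'cV[R]_m) (A : 'M[R]_(m, n)) (x : Rvec R n) :
  Rvec R m := [tuple ((c + A *m colv x) i 0 : measurableTypeR R) | i < m].

Lemma colv_affine m n (c : 'cV[R]_m) (A : 'M[R]_(m, n)) x :
  colv (affine c A x) = c + A *m colv x.
Proof. by apply/colP => i; rewrite mxE tnth_mktuple. Qed.

Lemma colv_inj n : injective (@colv R n).
Proof.
by move=> x y /colP xy; apply: eq_from_tnth => i; have := xy i; rewrite !mxE.
Qed.

Lemma measurable_colv n i :
  measurable_fun [set: Rvec R n] (fun x => colv x i 0).
Proof. by under eq_fun do rewrite mxE; exact: measurable_tnth. Qed.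

Lemma measurable_affine_coord m n (c : 'cV[R]_m) (A : 'M[R]_(m, n)) i :
  measurable_fun [set: Rvec R n] (fun x => (c + A *m colv x) i 0).
Proof.
under eq_fun do rewrite mxE [(_ *m _) _ _]mxE.
apply: measurable_funD => //; apply: measurable_sum => j.
by apply: measurable_funM => //; exact: measurable_colv.
Qed.

Lemma measurable_affine m n (c : 'cV[R]_m) (A : 'M[R]_(m, n)) :
  measurable_fun [set: Rvec R n] (affine c A).
Proof.
apply/measurable_fun_tnthP => i; rewrite /comp.
under eq_fun do rewrite tnth_mktuple.
exact: measurable_affine_coord.
Qed.

End affine.

Section real_affine.
Context (R : realType).
Local Notation mu := (@lebesgue_measure R).
Local Open Scope ereal_scope.

Let aff (a b : R) (t : measurableTypeR R) : measurableTypeR R := (a * t + b)%R.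

Let measurable_aff a b : measurable_fun [set: measurableTypeR R] (aff a b).
Proof. by apply: measurable_funD => //; exact: measurable_funM. Qed.

(** Lebesgue measure is determined by half-open intervals, whose preimages are
    intervals of lengths divided by [`|a|]; for [a < 0] their ends are swapped,
    which does not change their measure. *)
Let pushforward_aff a b (A : set (measurableTypeR R)) : a != 0%R ->
  measurable A -> mu A = `|a|%:E * pushforward mu (aff a b) A.
Proof.
move=> a0 mA.
pose nu : {measure set (measurableTypeR R) -> \bar R} :=
  mscale (NngNum (normr_ge0 a))
    (measure_function_pushforward__canonical__measure_function_Measure mu
       (measurable_aff a b)).
apply: (@lebesgue_measure_unique _ nu) => //= _ [[x y]] _ <-.
rewrite /nu /mscale/= /pushforward.
have [a_gt0|a_lt0|/eqP] := ltgtP 0%R a; last by rewrite eq_sym (negbTE a0).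
- rewrite (_ : _ @^-1` _ = `](x - b) / a, (y - b) / a]%classic)%R; last first.
    apply/seteqP; split => t /=; rewrite !in_itv/= /aff.
      by rewrite ltr_pdivrMr// ler_pdivlMr// mulrC ltrBlDr lerBrDr.
    by rewrite ltr_pdivrMr// ler_pdivlMr// mulrC ltrBlDr lerBrDr.
  rewrite !lebesgue_measure_itv/= !lte_fin ltr_pM2r ?invr_gt0// ltrD2r.
  case: ifPn => _; last by rewrite mule0.
  rewrite -!EFinD -EFinM gtr0_norm//; congr EFin.
  by field; rewrite gt_eqF.
- rewrite (_ : _ @^-1` _ = `[(y - b) / a, (x - b) / a[%classic)%R; last first.
    apply/seteqP; split => t /=; rewrite !in_itv/= /aff.
      by rewrite ltr_ndivlMr// ler_ndivrMr// mulrC ltrBlDr lerBrDr andbC.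
    by rewrite ltr_ndivlMr// ler_ndivrMr// mulrC ltrBlDr lerBrDr andbC.
  rewrite !lebesgue_measure_itv/= !lte_fin ltr_nM2r ?invr_lt0// ltrD2r.
  case: ifPn => _; last by rewrite mule0.
  rewrite -!EFinD -EFinM ltr0_norm//; congr EFin.
  by field; rewrite lt_eqF.
Qed.

Lemma ge0_integral_affine1 (a b : R) (f : measurableTypeR R -> \bar R) :
  a != 0%R -> measurable_fun [set: measurableTypeR R] f ->
  (forall t, 0 <= f t) ->
  \int[mu]_t f (a * t + b)%R = `|a|^-1%:E * \int[mu]_t f t.
Proof.
move=> a0 mf f0.
have -> : \int[mu]_t f t = `|a|%:E * \int[pushforward mu (aff a b)]_t f t.
  rewrite -(@ge0_integral_mscale _ _ _
    (measure_function_pushforward__canonical__measure_function_Measure mu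
       (measurable_aff a b)) _ _ (NngNum (normr_ge0 a)))//.
  by apply: eq_measure_integral => A mA _; exact: pushforward_aff.
rewrite ge0_integral_pushforward// preimage_setT.
by rewrite muleA -EFinM mulVf ?normr_eq0// mul1e.
Qed.

End real_affine.

Section affine_substitution.
Context (R : realType).
Local Open Scope ereal_scope.

(** The Jacobian formula for all maps [x |-> c + A x] with linear part A.  The
    translation is quantified inside, because peeling off one coordinate of a
    triangular map produces a translation of the others that depends on it. *)
Definition affine_substitution n (A : 'M[R]_n) : Prop :=
  forall c (f : Rvec R n -> \bar R), measurable_fun [set: Rvec R n] f ->
    (forall x, 0 <= f x) ->
    \int[lebesgue_vec R n]_x f (affine c A x) =
    `|\det A|^-1%:E * \int[lebesgue_vec R n]_x f x.

Lemma affine_affine m n p c d (A : 'M[R]_(m, n)) (B : 'M[R]_(n, p)) x :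
  affine c A (affine d B x) = affine (c + A *m d)%R (A *m B) x.
Proof. by apply: colv_inj; rewrite !colv_affine mulmxDr mulmxA addrA. Qed.

Lemma affineK n c (A : 'M[R]_n) : A \in unitmx ->
  cancel (affine c A) (affine (- (invmx A *m c))%R (invmx A)).
Proof.
by move=> uA x; apply: colv_inj; rewrite !colv_affine mulmxDr mulKmx// addKr.
Qed.

Lemma affine_substitution_mul n (A B : 'M[R]_n) :
  affine_substitution A -> affine_substitution B ->
  affine_substitution (A *m B).
Proof.
move=> sA sB c f mf f0.
transitivity (\int[lebesgue_vec R n]_x f (affine c A (affine 0%R B x))).
  by apply: eq_integral => x _; rewrite affine_affine mulmx0 addr0.
rewrite (sB 0%R (fun x => f (affine c A x)))//; last first.
  by apply: (measurableT_comp mf); exact: measurable_affine.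
by rewrite sA// muleA -EFinM det_mulmx normrM invfM mulrC.
Qed.

Lemma colv_vcons n (t : measurableTypeR R) (x : Rvec R n) :
  colv (vcons (t, x)) = col_mx (t : R)%:M (colv x) :> 'cV_(1 + n).
Proof.
apply/colP => i; rewrite !mxE; case: splitP => j ij.
  rewrite (ord1 j) mxE eqxx mulr1n (_ : i = ord0)//.
  by apply/val_inj => /=; rewrite ij (ord1 j).
rewrite mxE (_ : i = lift ord0 j) ?tnthS//.
exact/val_inj.
Qed.

Lemma affine_vcons n (c : 'cV[R]_(1 + n)) a b d (D : 'M[R]_n) t x :
  affine c (block_mx a%:M b d D) (vcons (t, x)) =
  vcons (a * t + (b *m colv x + usubmx c) 0 0,
         affine (dsubmx c + (t : R) *: d)%R D x)%R.
Proof.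
apply: colv_inj; rewrite colv_affine !colv_vcons colv_affine.
rewrite -{1}[c]vsubmxK mul_block_col add_col_mx -scalar_mxM mul_mx_scalar.
congr col_mx; last by rewrite addrA.
by apply/matrixP => i j; rewrite !ord1 !mxE /= !mulr1n; ring.
Qed.

Let measurable_vcons_l n (f : Rvec R n.+1 -> \bar R) x :
  measurable_fun [set: Rvec R n.+1] f ->
  measurable_fun [set: measurableTypeR R] (fun t => f (vcons (t, x))).
Proof.
move=> mf; apply: (measurableT_comp mf).
exact: (measurableT_comp (@measurable_vcons R n) (measurable_pair2 _)).
Qed.

Let measurable_vcons_r n (f : Rvec R n.+1 -> \bar R) t :
  measurable_fun [set: Rvec R n.+1] f ->
  measurable_fun [set: Rvec R n] (fun x => f (vcons (t, x))).
Proof.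
move=> mf; apply: (measurableT_comp mf).
exact: (measurableT_comp (@measurable_vcons R n) (measurable_pair1 _)).
Qed.

(** For a fixed tail, the head coordinate undergoes an affine map of slope a;
    the tail itself is moved by D alone. *)
Lemma affine_substitution_ublock n a b (D : 'M[R]_n) : a != 0%R ->
  affine_substitution D ->
  affine_substitution (block_mx a%:M b 0%R D : 'M[R]_(1 + n)).
Proof.
move=> a0 sD c f mf f0.
have mfv : measurable_fun [set: (measurableTypeR R * Rvec R n)%type]
    (fun z => f (vcons z)).
  by apply: (measurableT_comp mf); exact: measurable_vcons.
pose F x := \int[@lebesgue_measure R]_t f (vcons (t, x)).
have mF : measurable_fun [set: Rvec R n] F.
  exact: (measurable_fun_fubini_tonelli_G (fun z => f (vcons z))).
have F0 x : 0 <= F x by exact: integral_ge0.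
rewrite ge0_integral_lebesgue_vecS_swap//; last first.
  by apply: (measurableT_comp mf); exact: measurable_affine.
transitivity (\int[lebesgue_vec R n]_x
    (`|a|^-1%:E * F (affine (dsubmx c) D x))).
  apply: eq_integral => x _; under eq_integral do
    rewrite affine_vcons scaler0 addr0.
  rewrite (@ge0_integral_affine1 _ _ _
    (fun s => f (vcons (s, affine (dsubmx c) D x))))//.
  exact: measurable_vcons_l.
rewrite ge0_integralZl//; last first.
  by apply: (measurableT_comp mF); exact: measurable_affine.
rewrite sD// -ge0_integral_lebesgue_vecS_swap// muleA -EFinM.
by rewrite det_ublock det_scalar1 normrM invfM.
Qed.

(** For a fixed head t, the tail undergoes a map of linear part D translated by
    [t d]; the head itself is moved by its own affine map. *)
Lemma affine_substitution_lblock n a d (D : 'M[R]_n) : a != 0%R ->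
  affine_substitution D ->
  affine_substitution (block_mx a%:M 0%R d D : 'M[R]_(1 + n)).
Proof.
move=> a0 sD c f mf f0.
have mfv : measurable_fun [set: (measurableTypeR R * Rvec R n)%type]
    (fun z => f (vcons z)).
  by apply: (measurableT_comp mf); exact: measurable_vcons.
pose F t := \int[lebesgue_vec R n]_x f (vcons (t, x)).
have mF : measurable_fun [set: measurableTypeR R] F.
  exact: (measurable_fun_fubini_tonelli_F (fun z => f (vcons z))).
have F0 t : 0 <= F t by exact: integral_ge0.
rewrite ge0_integral_lebesgue_vecS//; last first.
  by apply: (measurableT_comp mf); exact: measurable_affine.
transitivity (\int[@lebesgue_measure R]_t
    (`|\det D|^-1%:E * F (a * t + usubmx c 0 0)%R)).
  apply: eq_integral => t _; under eq_integral do
    rewrite affine_vcons mul0mx add0r.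
  by rewrite (sD _ (fun x => f (vcons ((a * t + usubmx c 0 0)%R, x))))//;
    exact: measurable_vcons_r.
rewrite ge0_integralZl//; last first.
  by apply: (measurableT_comp mF); apply: measurable_funD => //;
    exact: measurable_funM.
rewrite ge0_integral_affine1// -ge0_integral_lebesgue_vecS// muleA -EFinM.
by rewrite det_lblock det_scalar1 normrM invfM [X in _ = X%:E * _]mulrC.
Qed.

Lemma affine_substitution_dim0 (A : 'M[R]_0) : affine_substitution A.
Proof.
move=> c f mf f0; rewrite det_mx00 normr1 invr1 mul1e.
by apply: eq_integral => x _; rewrite [affine _ _ _]tuple0 [x]tuple0.
Qed.

(** Reflections send the lower set defining a distribution function to an
    orthant. *)
Lemma affine_substitutionN1 n : affine_substitution (- 1%:M : 'M[R]_n).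
Proof.
elim: n => [|n IH]; first exact: affine_substitution_dim0.
rewrite -[n.+1]/(1 + n)%N (@scalar_mx_block _ 1 n) opp_block_mx !oppr0.
by rewrite -raddfN; apply: affine_substitution_ublock => //; rewrite oppr_eq0.
Qed.

End affine_substitution.

(** * Cholesky factorization *)
Section cholesky.
Context (R : realType).

(** The Schur complement represents the form restricted to the vectors
    [(- b y / a, y)], which are those that the form makes orthogonal to the
    first basis vector. *)
Let schur n (a : R) (b : 'rV[R]_n) (C : 'M[R]_n) :
  posdef (block_mx a%:M b b^T C : 'M[R]_(1 + n)) ->
  0 < a /\ posdef (C - a^-1 *: (b^T *m b)).
Proof.
move=> [symQ posQ]; have a0 : 0 < a.
  have := posQ (col_mx 1%:M 0); rewrite tr_col_mx trmx1 trmx0.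
  rewrite mul_row_block !mul1mx !mul0mx !addr0 mul_row_col mulmx0 addr0 mulmx1.
  rewrite mxE eqxx mulr1n; apply; apply/eqP => /colP/(_ (lshift n 0)).
  by rewrite col_mxEu !mxE eqxx => /eqP; rewrite oner_eq0.
split=> //; split.
  rewrite linearB/= linearZ/= trmx_mul trmxK; congr (_ - _).
  by move: symQ; rewrite tr_block_mx => /eq_block_mx[].
move=> y y0; pose t := - (a^-1 *: (b *m y)).
have := posQ (col_mx t y); rewrite -mulmxA mul_block_col tr_col_mx mul_row_col.
rewrite mul_scalar_mx /t scalerN scalerA mulfV ?gt_eqF// scale1r addNr mulmx0.
rewrite add0r -[(y^T *m _ *m y)]mulmxA mulmxBl -scalemxAl -(mulmxA b^T).
rewrite (addrC (C *m y)) => pos; rewrite scalemxAr -mulmxN; apply: pos.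
apply: contra_neq y0 => /(congr1 (@dsubmx _ 1 n 1)).
by rewrite col_mxKd linear0.
Qed.

(** With a the first diagonal entry of Q and b the rest of its first row, the
    factor is B = [sqrt a, b / sqrt a; 0, B1] with B1 the factor of the Schur
    complement.  The substitution property is carried along for B and for its
    transpose, so that it holds for Q itself. *)
Lemma posdef_cholesky n (Q : 'M[R]_n) : posdef Q ->
  exists B : 'M[R]_n, [/\ Q = B^T *m B, B \in unitmx,
    affine_substitution B & affine_substitution B^T].
Proof.
elim: n Q => [|n IH] Q posQ.
  exists 0; split; try exact: affine_substitution_dim0.
    by apply/matrixP => -[].
  by rewrite unitmxE det_mx00 unitr1.
pose Q' : 'M[R]_(1 + n) := Q; pose a := Q' 0 0; pose b := ursubmx Q'.
have QE : Q = block_mx a%:M b b^T (drsubmx Q') :> 'M[R]_(1 + n).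
  rewrite -[LHS](@submxK _ 1 n 1 n); congr block_mx.
    by rewrite [LHS]mx11_scalar !mxE; congr (Q _ _)%:M; exact/val_inj.
  by rewrite /b trmx_ursub /Q' (proj1 posQ).
have [|a0 /IH[B1 [QB1 uB1 sB1 sB1T]]] := @schur n a b (drsubmx Q').
  by rewrite -QE.
have ra0 : Num.sqrt a != 0 by rewrite gt_eqF// sqrtr_gt0.
pose B : 'M[R]_(1 + n) :=
  block_mx (Num.sqrt a)%:M ((Num.sqrt a)^-1 *: b) 0 B1.
have BT : B^T = block_mx (Num.sqrt a)%:M 0 ((Num.sqrt a)^-1 *: b)^T B1^T.
  by rewrite tr_block_mx tr_scalar_mx trmx0.
have QB : Q' = B^T *m B.
  rewrite BT mulmx_block !mul0mx !mulmx0 !addr0 -scalar_mxM -expr2.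
  rewrite sqr_sqrtr ?ltW// mul_scalar_mx mul_mx_scalar scalerA linearZ/=.
  rewrite scalerA mulfV// !scale1r -scalemxAl -scalemxAr scalerA -invfM -expr2.
  by rewrite sqr_sqrtr ?ltW// -QB1 addrC subrK -QE.
exists B; split => //.
- rewrite unitmxE (@det_ublock _ 1 n) det_scalar1 unitfE mulf_neq0//.
  by rewrite -unitfE -unitmxE.
- exact: affine_substitution_ublock.
- by rewrite BT; exact: affine_substitution_lblock.
Qed.

Lemma posdef_unitmx n (Q : 'M[R]_n) : posdef Q -> Q \in unitmx.
Proof.
by move=> /posdef_cholesky[B [-> uB _ _]]; rewrite unitmx_mul unitmx_tr uB.
Qed.

Lemma posdef_det_gt0 n (Q : 'M[R]_n) : posdef Q -> 0 < \det Q.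
Proof.
move=> /posdef_cholesky[B [-> uB _ _]]; rewrite det_mulmx det_tr -expr2.
by rewrite exprn_even_gt0//= -unitfE -unitmxE.
Qed.

Lemma posdef_affine_substitution n (Q : 'M[R]_n) :
  posdef Q -> affine_substitution Q.
Proof.
by move=> /posdef_cholesky[B [-> _ ? ?]]; exact: affine_substitution_mul.
Qed.

End cholesky.

(** * Products of one-dimensional weights *)
Section has_integral.
Context d (T : measurableType d) (R : realType).
Variable mu : {measure set T -> \bar R}.
Implicit Types (f g : T -> R) (r s : R).

(** Integrability and the value of the integral travel together, since linearity
    of the signed integral requires the former at every step. *)
Definition has_integral f r : Prop :=
  mu.-integrable setT (EFin \o f) /\ (\int[mu]_x (f x)%:E = r%:E)%E.

Lemma has_integral_ge0 f r : measurable_fun setT f -> (forall x, 0 <= f x) ->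
  (\int[mu]_x (f x)%:E = r%:E)%E -> has_integral f r.
Proof.
move=> mf f0 fr; split => //; apply/integrableP; split.
  exact/measurable_EFinP.
by under eq_integral do rewrite /= ger0_norm//; rewrite fr ltry.
Qed.

Lemma eq_has_integral f g r : f =1 g -> has_integral f r -> has_integral g r.
Proof. by move=> /funext ->. Qed.

Lemma has_integral0 : has_integral (cst 0) 0.
Proof. by split; [exact: integrable0|rewrite integral0_eq]. Qed.

Lemma has_integralD f g r s : has_integral f r -> has_integral g s ->
  has_integral (fun x => f x + g x) (r + s).
Proof.
move=> [intf fr] [intg gs]; split; first exact: (integrableD _ intf intg).
by rewrite (integralD _ intf intg)// fr gs.
Qed.

Lemma has_integralZ k f r : has_integral f r ->
  has_integral (fun x => k * f x) (k * r).
Proof.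
move=> [intf fr]; split; first exact: (integrableZl _ _ intf).
by under eq_integral do rewrite EFinM; rewrite (integralZl _ intf)// fr EFinM.
Qed.

Lemma has_integralN f r : has_integral f r ->
  has_integral (fun x => - f x) (- r).
Proof.
move=> /(has_integralZ (-1)); rewrite mulN1r; apply: eq_has_integral => x.
by rewrite mulN1r.
Qed.

Lemma has_integral_sum n (f : 'I_n -> T -> R) (r : 'I_n -> R) :
  (forall i, has_integral (f i) (r i)) ->
  has_integral (fun x => \sum_i f i x) (\sum_i r i).
Proof.
elim: n f r => [|n IH] f r fr.
  rewrite big_ord0; apply: eq_has_integral has_integral0 => x.
  by rewrite big_ord0.
rewrite big_ord_recl; apply: eq_has_integral
  (has_integralD (fr ord0) (IH _ _ (fun i => fr (lift ord0 i)))) => x.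
by rewrite big_ord_recl.
Qed.

End has_integral.

Section product_integral.
Context (R : realType).
Local Notation mu := (@lebesgue_measure R).

Lemma measurable_tnth_prod n (f : 'I_n -> R -> R) :
  (forall i, measurable_fun setT (f i)) ->
  measurable_fun [set: Rvec R n] (fun x => \prod_i f i (tnth x i)).
Proof.
move=> mf; apply: measurable_prod => i _.
by apply: (measurableT_comp (mf i)); exact: measurable_tnth.
Qed.

Let prod_vcons n (f : 'I_n.+1 -> R -> R)
    (z : (measurableTypeR R * Rvec R n)%type) :
  \prod_i f i (tnth (vcons z) i) =
  f ord0 z.1 * \prod_i f (lift ord0 i) (tnth z.2 i).
Proof.
by rewrite big_ord_recl; congr (_ * _); apply: eq_bigr => i _; rewrite tnthS.
Qed.

(** Fubini, one coordinate at a time. *)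
Lemma has_integral_tnth_prod n (f : 'I_n -> R -> R) (r : 'I_n -> R) :
  (forall i, has_integral mu (f i) (r i)) ->
  has_integral (lebesgue_vec R n)
    (fun x : Rvec R n => \prod_i f i (tnth x i)) (\prod_i r i).
Proof.
elim: n f r => [|n IH] f r fr.
  have m1 : measurable_fun [set: Rvec R 0]
      (fun x : Rvec R 0 => (\prod_i f i (tnth x i))%:E).
    by under eq_fun do rewrite big_ord0; exact: measurable_cst.
  split.
    apply/integrableP; split => //; rewrite integral_dirac//.
      by rewrite diracT mul1e ltry.
    exact: measurableT_comp.
  by rewrite integral_dirac// diracT mul1e !big_ord0.
have [intG IG] := IH _ _ (fun i => fr (lift ord0 i)).
have intf i := (fr i).1.
have mf i : measurable_fun [set: measurableTypeR R] (f i).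
  by apply/measurable_EFinP; exact: measurable_int (intf i).
pose h x : \bar R := (\prod_i f i (tnth x i))%:E.
have mh : measurable_fun [set: Rvec R n.+1] h.
  by apply/measurable_EFinP; exact: measurable_tnth_prod.
have mhv : measurable_fun [set: (measurableTypeR R * Rvec R n)%type]
    (h \o @vcons R n).
  by apply: (measurableT_comp mh); exact: measurable_vcons.
have inth : (mu \x lebesgue_vec R n)%E.-integrable setT (h \o @vcons R n).
  apply/integrable12ltyP => //.
  have mG : measurable_fun [set: Rvec R n]
      (fun x => `|(\prod_i f (lift ord0 i) (tnth x i))%:E|%E).
    by apply: measurableT_comp => //; exact: measurable_int intG.
  rewrite [ltLHS](_ : _ = \int[mu]_t (`|(f ord0 t)%:E| *
      \int[lebesgue_vec R n]_x `|(\prod_i f (lift ord0 i) (tnth x i))%:E|))%E.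
    2: by apply: eq_integral => t _; rewrite -ge0_integralZl//;
      apply: eq_integral => x _; rewrite /h /comp prod_vcons EFinM abseM.
  rewrite ge0_integralZr//; last 2 first.
    by apply: measurableT_comp => //; exact: measurable_int (intf ord0).
    exact: integral_ge0.
  have /integrableP[_ f0oo] := intf ord0; have /integrableP[_ Goo] := intG.
  rewrite lte_mul_pinfty//; first exact: integral_ge0.
  by rewrite ge0_fin_numE// integral_ge0.
split; first exact: (@integrable_pushforward _ _ _ _ _ _ (@measurable_vcons R n)).
rewrite [LHS](@integral_pushforward _ _ _ _ _ _ (@measurable_vcons R n))//.
rewrite preimage_setT -integral12_prod_meas1//= /fubini_F.
transitivity (\int[mu]_t ((f ord0 t)%:E *
    (\prod_(i < n) r (lift ord0 i))%:E))%E.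
  apply: eq_integral => t _; rewrite -IG -integralZl//.
  by apply: eq_integral => x _; rewrite /h/= prod_vcons EFinM.
rewrite integralZr//; last exact: intf.
by rewrite (fr ord0).2 big_ord_recl EFinM.
Qed.


(** Moments 1, c, 1 in orders 0, 1, 2, as for the density of a real law of mean c
    and second moment 1. *)
Definition unit_weight (w : R -> R) (c : R) : Prop := forall k, (k <= 2)%N ->
  has_integral mu (fun t => t ^+ k * w t) (c ^+ (k == 1%N)).

Lemma has_integral_monomial n w c (e : 'I_n -> nat) : unit_weight w c ->
  (forall i, e i <= 2)%N ->
  has_integral (lebesgue_vec R n)
    (fun x => (\prod_i (tnth x i : R) ^+ e i) * \prod_i w (tnth x i))
    (\prod_i c ^+ (e i == 1%N)).
Proof.
move=> wc e2.
apply: eq_has_integral (has_integral_tnth_prod (fun i => wc _ (e2 i))).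
by move=> x; rewrite big_split.
Qed.

Lemma has_integral_weight n w c : unit_weight w c ->
  has_integral (lebesgue_vec R n) (fun x => \prod_i w (tnth x i)) 1.
Proof.
move=> wc; have := @has_integral_monomial n w c (fun=> 0%N) wc (fun=> isT).
rewrite big1//; apply: eq_has_integral => x.
by rewrite mul1r.
Qed.

(** Squared mean plus variance, for independent coordinates of mean c and
    variance [1 - c ^ 2]. *)
Lemma has_integral_sqr_affine n w c (v : R) (a : 'I_n -> R) :
  unit_weight w c ->
  has_integral (lebesgue_vec R n)
    (fun x => (v + \sum_i a i * tnth x i) ^+ 2 * \prod_i w (tnth x i))
    ((v + c * \sum_i a i) ^+ 2 + (1 - c ^+ 2) * \sum_i a i ^+ 2).
Proof.
move=> wc.
have m0 := has_integral_weight n wc.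
have prod1 (t : 'I_n -> R) i : \prod_k t k ^+ (k == i) = t i.
  rewrite (bigD1 i)//= eqxx expr1 big1 ?mulr1// => k /negbTE ->.
  by rewrite expr0.
have m1 i : has_integral (lebesgue_vec R n)
    (fun x => (tnth x i : R) * \prod_i w (tnth x i)) c.
  have := @has_integral_monomial n w c (fun k => (k == i)%N) wc.
  rewrite (eq_bigr (fun k => c ^+ (k == i))) => [|k _]; last by case: (k == i).
  rewrite (prod1 (fun=> c)) => H; apply: eq_has_integral (H _) => [x|k].
    by rewrite (prod1 (fun k => tnth x k)).
  by case: (k == i).
have m2 i j : has_integral (lebesgue_vec R n)
    (fun x => (tnth x i : R) * tnth x j * \prod_i w (tnth x i))
    (c ^+ 2 + (1 - c ^+ 2) * (i == j)%:R).
  have := @has_integral_monomial n w c (fun k => (k == i) + (k == j))%N wc.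
  have -> : \prod_k c ^+ ((k == i) + (k == j) == 1)%N =
      c ^+ 2 + (1 - c ^+ 2) * (i == j)%:R.
    have [<-|ij] := eqVneq i j.
      by rewrite mulr1 subrKC big1// => k _; case: (k == i).
    rewrite mulr0 addr0 expr2 -[X in X * _](prod1 (fun=> c) i).
    rewrite -[X in _ * X](prod1 (fun=> c) j) -big_split/=.
    apply: eq_bigr => k _; rewrite -exprD.
    have [->|_] := eqVneq k i; last by case: (k == j).
    by rewrite (negbTE ij).
  move=> H; apply: eq_has_integral (H _) => [x|k].
    congr (_ * _); under eq_bigr do rewrite exprD; rewrite big_split/=.
    by rewrite !(prod1 (fun k => tnth x k)).
  by case: (k == i); case: (k == j).
have -> : (v + c * \sum_i a i) ^+ 2 + (1 - c ^+ 2) * \sum_i a i ^+ 2 =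
    v ^+ 2 * 1 + (\sum_i (2 * v * a i) * c
    + \sum_i \sum_j (a i * a j) * (c ^+ 2 + (1 - c ^+ 2) * (i == j)%:R)).
  have -> : \sum_i 2 * v * a i * c = 2 * v * c * \sum_i a i.
    by rewrite mulr_sumr; apply: eq_bigr => i _; ring.
  have -> : \sum_i \sum_j a i * a j * (c ^+ 2 + (1 - c ^+ 2) * (i == j)%:R) =
      c ^+ 2 * (\sum_i a i) ^+ 2 + (1 - c ^+ 2) * \sum_i a i ^+ 2.
    rewrite [(\sum_i a i) ^+ 2]expr2 mulr_suml !mulr_sumr -big_split/=.
    apply: eq_bigr => i _; under eq_bigr do rewrite mulrDr; rewrite big_split/=; congr (_ + _).
      by rewrite !mulr_sumr; apply: eq_bigr => j _; ring.
    rewrite (bigD1 i)//= eqxx mulr1 big1 ?addr0; first by ring.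
    by move=> j /negbTE ji; rewrite eq_sym ji !mulr0.
  by ring.
apply: eq_has_integral; last first.
  apply: has_integralD; first exact: has_integralZ m0.
  apply: has_integralD.
    by apply: has_integral_sum => i; exact: has_integralZ (m1 i).
  apply: has_integral_sum => i; apply: has_integral_sum => j.
  exact: has_integralZ (m2 i j).
move=> x /=; set W := \prod_i w _.
have -> : \sum_i 2 * v * a i * (tnth x i * W) =
    2 * v * (\sum_i a i * tnth x i) * W.
  by rewrite mulr_sumr mulr_suml; apply: eq_bigr => i _; rewrite !mulrA.
have -> : \sum_i \sum_j a i * a j * (tnth x i * tnth x j * W) =
    (\sum_i a i * tnth x i) ^+ 2 * W.
  rewrite expr2 !mulr_suml; apply: eq_bigr => i _.
  by rewrite mulr_sumr mulr_suml; apply: eq_bigr => j _; ring.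
by ring.
Qed.

End product_integral.

(** * Moments of the normal and half-normal laws *)
Section std_normal.
Context (R : realType).
Local Notation mu := (@lebesgue_measure R).
Local Notation N := (normal_pdf 0 1 : R -> R).

Lemma std_normal_pdfE t : N t = (Num.sqrt (2 * pi))^-1 * expR (- t ^+ 2 / 2).
Proof.
rewrite normal_pdfE ?oner_eq0//= /normal_peak /normal_fun subr0 expr1n mul1r.
by rewrite mulr_natl.
Qed.

Lemma std_normal_pdfN t : N (- t) = N t.
Proof. by rewrite !std_normal_pdfE sqrrN. Qed.

Let continuous_N : continuous N.
Proof. by apply: continuous_normal_pdf; rewrite oner_eq0. Qed.

Let N_ge0 t : 0 <= N t. Proof. exact: normal_pdf_ge0. Qed.

Let measurable_N : measurable_fun [set: R] N.
Proof. exact: measurable_normal_pdf. Qed.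

Lemma is_derive_std_normal_pdf (t : R) : is_derive t 1 N (- (t * N t)).
Proof.
have -> : N = (Num.sqrt (2 * pi))^-1 \*: (expR \o (- 2^-1 \*: (@id R ^+ 2))).
  apply/funext => x; rewrite std_normal_pdfE/= mulNr scaleNr.
  by rewrite [X in expR (- X)]mulrC.
apply: is_derive_eq; rewrite /= /GRing.scale/= expr1 mulr1.
set k := (Num.sqrt _)^-1; set e := expR _.
rewrite [RHS](_ : _ = k * (- t * e)); last by ring.
by congr (_ * _); field.
Qed.

Lemma cvg_std_normal_pdf : N t @[t --> +oo%R] --> (0 : R).
Proof.
rewrite -[X in _ --> X](mulr0 (Num.sqrt (2 * pi))^-1).
rewrite (_ : (fun t => N t) =
    (fun t => (Num.sqrt (2 * pi))^-1 * expR (- (2^-1 * t ^+ 2)))); last first.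
  by apply/funext => x; rewrite std_normal_pdfE mulNr (mulrC 2^-1).
apply: cvgMr; apply: (cvg_comp (fun t => 2^-1 * t ^+ 2) (fun t => expR (- t))).
  by apply: gt0_cvgMry; [rewrite invr_gt0|exact: cvgr_expr2].
exact: cvgr_expR.
Qed.

(** [- N] is a primitive of [t * N t]. *)
Lemma integral_std_normal_tail s : 0 <= s ->
  (\int[mu]_(t in `[s, +oo[) (t * N t)%:E = (N s)%:E)%E.
Proof.
move=> s0; rewrite (@ge0_continuous_FTC2y _ _ (fun t => - N t) _ 0)//.
- by rewrite EFinN oppeK add0e.
- by move=> x sx; rewrite mulr_ge0// (le_trans s0).
- by apply: continuous_subspaceT => x; apply: cvgM => //; exact: continuous_N.
- by rewrite -[X in _ --> X]oppr0; apply: cvgN; exact: cvg_std_normal_pdf.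
- move=> x _; apply: derivableN.
  exact: (@ex_derive _ _ _ _ _ _ _ (is_derive_std_normal_pdf x)).
- by apply: cvg_at_right_filter; apply: cvgN; exact: continuous_N.
- move=> x _; rewrite derive1E deriveN; last first.
    exact: (@ex_derive _ _ _ _ _ _ _ (is_derive_std_normal_pdf x)).
  by rewrite (@derive_val _ _ _ _ _ _ _ (is_derive_std_normal_pdf x)) opprK.
Qed.

Let halfline : [set x : R | 0 <= x] = `[0, +oo[%classic.
Proof. by rewrite -set_itvcy. Qed.

Lemma integral_std_normal_half :
  (\int[mu]_(t in `[0%R, +oo[) (N t)%:E = 2^-1%:E)%E.
Proof.
have := integral_normal_pdf (0 : R) 1.
rewrite ge0_symfun_integralT//; last by move=> x /=; rewrite std_normal_pdfN.
rewrite halfline => /(congr1 (fun x => 2^-1%:E * x)%E).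
by rewrite muleA -EFinM mulVf// mul1e mule1.
Qed.

(** Write one factor t of [t ^ 2 * N t] as the length of [0, t].  Tonelli turns
    the integral into that of the tails [N s] of [t * N t], hence into half the
    total mass of N. *)
Lemma integral_sqr_std_normal_half :
  (\int[mu]_(t in `[0%R, +oo[) (t ^+ 2 * N t)%:E = 2^-1%:E)%E.
Proof.
pose f (z : (measurableTypeR R * measurableTypeR R)%type) : \bar R :=
  (if (0 <= z.1) && (z.1 <= z.2) then z.2 * N z.2 else 0)%:E.
have mf : measurable_fun setT f.
  apply/measurable_EFinP; apply: measurable_fun_ifT => //.
    by apply: measurable_and; exact: measurable_fun_ler.
  apply: measurable_funM => //.
  by apply: (measurableT_comp measurable_N); exact: measurable_snd.
have f0 z : (0 <= f z)%E.
  rewrite lee_fin /f; case: ifPn => // /andP[z1 z12].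
  by rewrite mulr_ge0// (le_trans z1).
rewrite -integral_std_normal_half.
transitivity (\int[mu]_s \int[mu]_t f (s, t))%E; last first.
  rewrite [RHS]integral_mkcond/=; apply: eq_integral => s _.
  rewrite patchE mem_setE in_itv/= andbT; case: ifPn => s0; last first.
    by rewrite integral0_eq// => t _; rewrite /f/= (negbTE s0).
  rewrite -integral_std_normal_tail// [RHS]integral_mkcond/=.
  apply: eq_integral => t _; rewrite patchE mem_setE in_itv/= andbT /f/= s0/=.
  by case: ifP.
rewrite fubini_tonelli// [LHS]integral_mkcond/=; apply: eq_integral => t _.
rewrite patchE mem_setE in_itv/= andbT; case: ifPn => t0; last first.
  rewrite integral0_eq// => s _; rewrite /f/=; case: ifP => // /andP[s0 st].
  by rewrite (le_trans s0 st) in t0.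
transitivity (\int[mu]_(s in `[0%R, t]) (t * N t)%:E)%E.
  rewrite integral_cst//= lebesgue_measure_itv/= lte_fin.
  have [t_gt0|] := ltP 0 t; last first.
    move=> t_le0; have -> : t = 0 by apply/eqP; rewrite eq_le t_le0.
    by rewrite expr2 !mul0r mule0.
  by rewrite sube0 -EFinM mulrAC.
rewrite integral_mkcond/=; apply: eq_integral => s _.
by rewrite patchE mem_setE in_itv/= /f/=; case: ifP.
Qed.

Lemma unit_weight_std_normal : unit_weight N 0.
Proof.
have m0 : has_integral mu (fun t => t ^+ 0 * N t) 1.
  apply: has_integral_ge0.
  - by under eq_fun do rewrite expr0 mul1r.
  - by move=> t; rewrite expr0 mul1r.
  - by under eq_integral do rewrite expr0 mul1r; exact: integral_normal_pdf.
have m2 : has_integral mu (fun t => t ^+ 2 * N t) 1.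
  apply: has_integral_ge0.
  - by apply: measurable_funM => //; exact: measurable_funX.
  - by move=> t; rewrite mulr_ge0// sqr_ge0.
  - rewrite ge0_symfun_integralT//.
    + rewrite halfline integral_sqr_std_normal_half -EFinM mulfV//.
    + by move=> t; rewrite mulr_ge0// sqr_ge0.
    + move=> t; apply: cvgM; last exact: continuous_N.
      exact: exprn_continuous.
    + by move=> t; rewrite /= sqrrN std_normal_pdfN.
have m1 : has_integral mu (fun t => t ^+ 1 * N t) 0.
  have int1 : mu.-integrable setT (EFin \o (fun t : R => t * N t)).
    apply: (le_integrable _ _ _ (has_integralD m0 m2).1) => //.
      apply/measurable_EFinP; exact: measurable_funM.
    move=> t _; rewrite lee_fin expr0 mul1r normrM (ger0_norm (N_ge0 t)).
    apply: le_trans (ler_norm _); rewrite -{2}[N t]mul1r -mulrDl ler_wpM2r//.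
    (* |t| <= 1 + t ^ 2 *)
    have := sqr_ge0 (`|t| - 1); rewrite -(real_normK (num_real t)).
    by have := normr_ge0 t; nra.
  (* the first moment is its own opposite, by the symmetry t |-> - t *)
  split; first by under eq_fun do rewrite expr1.
  under eq_integral do rewrite expr1.
  set I := (\int[mu]_t _)%E; have fI : I \is a fin_num.
    exact: integrable_fin_num int1.
  suff : I = (- I)%E.
    by rewrite -(fineK fI) -EFinN => -[] /eqP; rewrite -addr_eq0 -mulr2n
      mulrn_eq0/= => /eqP ->.
  pose opp : measurableTypeR R -> measurableTypeR R := -%R.
  have mopp : measurable_fun [set: measurableTypeR R] opp by exact: oppr_measurable.
  pose g : measurableTypeR R -> \bar R := EFin \o (fun t : R => t * N t).
  have gopp : g \o opp = (-%E) \o g.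
    apply/funext => t; rewrite /g /opp /=; congr (_%:E).
    by rewrite (std_normal_pdfN (t : R)) mulNr.
  have {1}-> : I = (\int[pushforward mu opp]_t g t)%E.
    by apply: eq_measure_integral => A mA _; exact/esym/lebesgue_measureN.
  rewrite (integral_pushforward mopp (f := g))//.
  - by rewrite preimage_setT gopp integralN// integrable_add_def.
  - exact: measurable_int int1.
  - by rewrite preimage_setT gopp; exact: integrableN.
by case=> [|[|[|//]]] _.
Qed.

Definition half_normal_pdf (t : R) : R := if 0 <= t then 2 * N t else 0.

Lemma unit_weight_half_normal : unit_weight half_normal_pdf (Num.sqrt (2 / pi)).
Proof.
have mh : measurable_fun [set: R] half_normal_pdf.
  apply: measurable_fun_ifT => //; first exact: measurable_fun_ler.
  exact: measurable_funM.
(* half-normal moments are twice those of N on the half-line *)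
have h k r : (\int[mu]_(t in `[0%R, +oo[) (t ^+ k * N t)%:E = r%:E)%E ->
    has_integral mu (fun t => t ^+ k * half_normal_pdf t) (2 * r).
  move=> kr; apply: eq_has_integral
    (_ : has_integral mu (fun t => if 0 <= t then 2 * (t ^+ k * N t) else 0) _).
    by move=> t; rewrite /half_normal_pdf; case: ifP; rewrite ?mulr0// mulrCA.
  apply: has_integral_ge0.
  - apply: measurable_fun_ifT => //; first exact: measurable_fun_ler.
    by apply: measurable_funM => //; exact: measurable_funM.
  - by move=> t; case: ifPn => // t0; rewrite !mulr_ge0// exprn_ge0.
  - rewrite EFinM -kr -ge0_integralZl//; last 2 first.
      by apply/measurable_EFinP/measurable_funTS/measurable_funM.
      move=> t; rewrite /= in_itv/= andbT => t0.
      by rewrite lee_fin mulr_ge0// exprn_ge0.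
    rewrite [RHS]integral_mkcond/=; apply: eq_integral => t _.
    by rewrite patchE mem_setE in_itv/= andbT; case: ifP.
case=> [|[|[|//]]] _.
- have := h 0%N 2^-1; rewrite mulfV//; apply.
  by under eq_integral do rewrite expr0 mul1r; exact: integral_std_normal_half.
(* the tail of t * N t from 0 on is N 0 *)
- have -> : Num.sqrt (2 / pi) ^+ (1 == 1)%N = 2 * N 0.
    rewrite std_normal_pdfE expr0n oppr0 mul0r expR0 mulr1 eqxx expr1.
    have pi0 := pi_gt0 R.
    rewrite -[RHS]ger0_norm ?divr_ge0// -sqrtr_sqr.
    rewrite expr_div_n sqr_sqrtr ?mulr_ge0 ?ltW//; congr Num.sqrt.
    by rewrite expr2 invfM mulrACA mulfV// mul1r.
  by apply: h; under eq_integral do rewrite expr1; exact: integral_std_normal_tail.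
- have := h 2%N 2^-1; rewrite mulfV//; apply.
  exact: integral_sqr_std_normal_half.
Qed.

End std_normal.

(** * Multivariate normal densities *)
Section gaussian.
Context (R : realType).

Definition sqn n (z : 'cV[R]_n) : R := (z^T *m z) 0 0.

Lemma sqnE n (z : 'cV[R]_n) : sqn z = \sum_i z i 0 ^+ 2.
Proof. by rewrite /sqn mxE; apply: eq_bigr => i _; rewrite mxE expr2. Qed.

Lemma sqn_ge0 n (z : 'cV[R]_n) : 0 <= sqn z.
Proof. by rewrite sqnE; apply: sumr_ge0 => i _; exact: sqr_ge0. Qed.

Lemma sqnZ n (r : R) (z : 'cV[R]_n) : sqn (r *: z) = r ^+ 2 * sqn z.
Proof. by rewrite /sqn -scalemxAr linearZ/= -scalemxAl scalerA mxE expr2. Qed.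

Lemma sqn_gt0 n (z : 'cV[R]_n) : z != 0 -> 0 < sqn z.
Proof.
move=> z0; rewrite lt_neqAle sqn_ge0 andbT eq_sym sqnE psumr_eq0; last first.
  by move=> i _; exact: sqr_ge0.
apply: contra z0 => /allP h; apply/eqP/colP => i; rewrite !mxE; apply/eqP.
by rewrite -sqrf_eq0; apply: h; rewrite mem_index_enum.
Qed.

Lemma enorm_sqn n (z : 'cV[R]_n) : enorm z = Num.sqrt (sqn z).
Proof. by rewrite /enorm sqnE. Qed.

Lemma sqn_mulmx m n (B : 'M[R]_(m, n)) z :
  sqn (B *m z) = (z^T *m (B^T *m B) *m z) 0 0.
Proof. by rewrite /sqn trmx_mul !mulmxA. Qed.

Lemma posdef_invmx n (S : 'M[R]_n) : posdef S -> posdef (invmx S).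
Proof.
move=> pS; have [symS posS] := pS; have uS := posdef_unitmx pS.
split; first by rewrite trmx_inv symS.
move=> x x0; have y0 : invmx S *m x != 0.
  apply: contra_neq x0 => /(congr1 (mulmx S)).
  by rewrite mulmxA mulmxV// mul1mx mulmx0.
have := posS _ y0; rewrite trmx_mul trmx_inv symS.
by rewrite -(mulmxA _ S) (mulmxA S) mulmxV// mul1mx.
Qed.

Lemma phiE n (z : 'cV[R]_n) :
  phi z = (Num.sqrt ((2 * pi) ^+ n))^-1 * expR (- sqn z / 2).
Proof. by rewrite /phi /mvnormal_pdf det1 mulr1 invmx1 mulmx1. Qed.

Lemma phi_gt0 n (z : 'cV[R]_n) : 0 < phi z.
Proof.
rewrite phiE mulr_gt0 ?expR_gt0// invr_gt0 sqrtr_gt0 exprn_gt0//.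
by rewrite mulr_gt0// pi_gt0.
Qed.

Lemma phi_prod n (z : 'cV[R]_n) : phi z = \prod_i normal_pdf 0 1 (z i 0).
Proof.
rewrite phiE; under eq_bigr do rewrite std_normal_pdfE.
rewrite big_split/= -expR_sum prodr_const card_ord exprVn; congr (_^-1 * _).
  elim: (n) => [|k IH]; first by rewrite !expr0 sqrtr1.
  by rewrite !exprS sqrtrM ?IH// mulr_ge0// pi_ge0.
by congr expR; rewrite sqnE -sumrN mulr_suml.
Qed.

Lemma ln_phi n (z : 'cV[R]_n) :
  ln (phi z) = - (n%:R / 2 * ln (2 * pi)) - sqn z / 2.
Proof.
have pi2 : 0 < 2 * pi :> R by rewrite mulr_gt0// pi_gt0.
have r0 : 0 < Num.sqrt ((2 * pi : R) ^+ n) by rewrite sqrtr_gt0 exprn_gt0.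
rewrite phiE [ln (_ * expR _)]lnM ?posrE ?expR_gt0 ?invr_gt0// expRK lnV ?posrE//.
rewrite mulNr; congr (- _ - _).
rewrite -powR12_sqrt ?exprn_ge0 ?(ltW pi2)// ln_powR lnXn// -(mulr_natl (ln _)).
by rewrite mulrCA mulrA.
Qed.

(** In the coordinates v of [B^T v], the quadratic form of [(B^T B)^-1] is the
    square of the Euclidean norm. *)
Lemma mvnormal_pdf_mulmx n (B : 'M[R]_n) v : B \in unitmx ->
  mvnormal_pdf (B^T *m B) (B^T *m v) = `|\det B|^-1 * phi v.
Proof.
move=> uB; have uBT : B^T \in unitmx by rewrite unitmx_tr.
rewrite phiE /mvnormal_pdf det_mulmx det_tr -expr2 sqrtrM; last first.
  by rewrite exprn_ge0// mulr_ge0// pi_ge0.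
rewrite sqrtr_sqr invfM mulrCA mulrA; congr (_ * expR (- _ / 2)).
have BB : invmx (B^T *m B) *m B^T = invmx B.
  by rewrite -[X in _ *m X](mulmxK uB) mulKmx// unitmx_mul uBT.
rewrite trmx_mul trmxK /sqn; congr (_ 0 0).
by rewrite -!mulmxA (mulmxA (invmx _)) BB mulKVmx.
Qed.

Lemma measurable_quadratic n (K : 'M[R]_n) : measurable_fun [set: Rvec R n]
  (fun x => ((colv x)^T *m K *m colv x) 0 0).
Proof.
under eq_fun do rewrite mxE; apply: measurable_sum => j.
apply: measurable_funM; last exact: measurable_colv.
under eq_fun do rewrite mxE; apply: measurable_sum => i.
under eq_fun do rewrite mxE.
by apply: measurable_funM => //; exact: measurable_colv.
Qed.

Lemma measurable_sqn n : measurable_fun [set: Rvec R n] (fun x => sqn (colv x)).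
Proof.
by have := @measurable_quadratic n 1%:M; under eq_fun do rewrite mulmx1.
Qed.

Lemma measurable_mvnormal_pdf n (S : 'M[R]_n) :
  measurable_fun [set: Rvec R n] (fun x => mvnormal_pdf S (colv x)).
Proof.
apply: measurable_funM => //; apply: measurableT_comp => //.
apply: measurable_funM => //; apply: measurableT_comp => //.
exact: measurable_quadratic.
Qed.

Lemma mvnormal_pdf_ge0 n (S : 'M[R]_n) z : 0 <= mvnormal_pdf S z.
Proof. by rewrite mulr_ge0 ?expR_ge0// invr_ge0. Qed.

Lemma integral_phi n :
  (\int[lebesgue_vec R n]_x (phi (colv x))%:E = 1)%E.
Proof.
have [_ <-] := has_integral_weight n (@unit_weight_std_normal R).
apply: eq_integral => x _; congr EFin; rewrite phi_prod.
by apply: eq_bigr => i _; rewrite mxE.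
Qed.

Lemma integral_mvnormal_pdf n (S : 'M[R]_n) : posdef S ->
  (\int[lebesgue_vec R n]_x (mvnormal_pdf S (colv x))%:E = 1)%E.
Proof.
move=> /posdef_cholesky[B [-> uB _ sB]].
have dB : `|\det B| != 0 by rewrite normr_eq0 -unitfE -unitmxE.
pose f x : \bar R := (mvnormal_pdf (B^T *m B) (colv x))%:E.
have mf : measurable_fun [set: Rvec R n] f.
  by apply/measurable_EFinP; exact: measurable_mvnormal_pdf.
have f0 x : (0 <= f x)%E by rewrite /f lee_fin mvnormal_pdf_ge0.
have := sB 0 f mf f0; rewrite [integral _ _ _](_ : _ = `|\det B|^-1%:E); last first.
  under eq_integral do
    rewrite /f colv_affine add0r mvnormal_pdf_mulmx// EFinM.
  rewrite ge0_integralZl//.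
  + by rewrite integral_phi mule1.
  + by apply/measurable_EFinP; exact: measurable_mvnormal_pdf.
  + by move=> x _; rewrite lee_fin ltW// phi_gt0.
rewrite det_tr => /(congr1 (fun x => `|\det B|%:E * x)%E).
by rewrite muleA -!EFinM mulfV// mul1e => <-.
Qed.

End gaussian.

(** * Completing the square *)
Section complete_the_square.
Context (R : realType) (n m : nat) (Delta : 'M[R]_(n, m)).
Let S : 'M[R]_m := 1%:M - Delta^T *m Delta.
Let K : 'M[R]_m := invmx S.

(** The inverse of the covariance of Z given [U = u] when
    [U = Delta^T Z - Y] with Z standard normal and Y normal of covariance S
    independent of Z. *)
Definition posterior_precision : 'M[R]_n := 1%:M + Delta *m K *m Delta^T.
Let Q := posterior_precision.

(** [x^T S x = |x| ^ 2 - |Delta x| ^ 2], and the hypothesis is applied to x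
    normalized. *)
Lemma skewness_matrix_posdef : skewness_matrix Delta -> posdef S.
Proof.
move=> skew; split; first by rewrite linearB/= trmx1 trmx_mul trmxK.
move=> x x0; have x_gt0 := sqn_gt0 x0.
pose r := (Num.sqrt (sqn x))^-1.
have r2 : r ^+ 2 * sqn x = 1.
  by rewrite /r exprVn sqr_sqrtr ?ltW// mulVf// gt_eqF.
have r0 : 0 < r ^+ 2 by rewrite exprn_gt0// invr_gt0 sqrtr_gt0.
have := skew (r *: x); rewrite !enorm_sqn sqnZ r2 sqrtr1 => /(_ erefl).
rewrite -scalemxAr sqnZ -[X in _ < X]sqrtr1 ltr_sqrt// -r2 ltr_pM2l//.
rewrite sqn_mulmx -subr_gt0 mulmxBr mulmxBl mulmx1.
by rewrite [X in _ -> 0 < X]mxE [X in _ -> 0 < _ + X]mxE.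
Qed.

Hypothesis pS : posdef S.
Let uS : S \in unitmx. Proof. exact: posdef_unitmx. Qed.

Lemma posterior_precision_posdef : posdef Q.
Proof.
have [symK posK] := posdef_invmx pS.
split; first by rewrite linearD/= trmx1 !trmx_mul trmxK symK mulmxA.
move=> x x0; rewrite mulmxDr mulmxDl mulmx1 mxE.
rewrite ltr_pwDl//; first exact: sqn_gt0.
rewrite !mulmxA -(mulmxA _ Delta^T x) -[x^T *m Delta]trmxK trmx_mul trmxK.
by have [->|/posK/ltW//] := eqVneq (Delta^T *m x) 0; rewrite mulmx0 mxE.
Qed.

(** The Woodbury identity. *)
Lemma posterior_precision_inv : invmx Q = 1%:M - Delta *m Delta^T.
Proof.
have uQ := posdef_unitmx posterior_precision_posdef.
apply: (can_inj (mulKmx uQ)); rewrite mulmxV// mulmxDl mul1mx mulmxBr mulmx1.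
rewrite -(mulmxA (Delta *m K)) (mulmxA Delta^T).
have -> : Delta^T *m Delta = 1%:M - S by rewrite /S subKr.
rewrite mulmxBl mul1mx mulmxBr (mulmxA (Delta *m K)).
by rewrite [Delta *m K *m S](mulmxKV uS) subKr subrK.
Qed.

(** Both [det (1 - Delta Delta^T)] and [det S] are the determinant of
    [1, Delta; Delta^T, 1], by its two block triangular factorizations. *)
Lemma det_posterior_precision : \det Q = (\det S)^-1.
Proof.
rewrite -[LHS]invrK -det_inv posterior_precision_inv; congr _^-1.
have E : block_mx 1%:M Delta Delta^T 1%:M =
    block_mx 1%:M 0 Delta^T 1%:M *m block_mx 1%:M Delta 0 S.
  by rewrite mulmx_block !mul1mx !mulmx1 !mul0mx !addr0 /S subrKC.
have := congr1 determinant E.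
have -> : block_mx 1%:M Delta Delta^T 1%:M =
    block_mx (1%:M - Delta *m Delta^T) Delta 0 1%:M *m
    block_mx 1%:M 0 Delta^T 1%:M.
  by rewrite mulmx_block !mul1mx !mulmx1 !mul0mx !mulmx0 !add0r subrK.
by rewrite !det_mulmx !det_ublock det_lblock !det1 !mulr1 !mul1r.
Qed.

(** In terms of [v = z - Delta u] one has [Delta^T z - u = Delta^T v - S u]; the
    terms mixing u and v then cancel against those of [sqn z], and the terms in u
    add up to [u^T (S + Delta^T Delta) u]. *)
Lemma complete_the_square z u :
  sqn z + ((Delta^T *m z - u)^T *m K *m (Delta^T *m z - u)) 0 0 =
  ((z - Delta *m u)^T *m Q *m (z - Delta *m u)) 0 0 + sqn u.
Proof.
pose v := z - Delta *m u; have -> : z = v + Delta *m u by rewrite subrK.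
rewrite addrK.
have -> : Delta^T *m (v + Delta *m u) - u = Delta^T *m v - S *m u.
  by rewrite /S mulmxDr mulmxBl mul1mx opprB mulmxA addrA.
have [symS _] := pS.
have e1 : (v + Delta *m u)^T *m (v + Delta *m u) = v^T *m v +
    v^T *m Delta *m u + u^T *m Delta^T *m v + u^T *m (Delta^T *m Delta) *m u.
  by rewrite [(_ + _)^T]linearD/= trmx_mul mulmxDl !mulmxDr !mulmxA addrA.
have e2 (w : 'cV[R]_n) (M : 'M[R]_m) : M^T = M -> M \in unitmx ->
    (Delta^T *m w - M *m u)^T *m invmx M *m (Delta^T *m w - M *m u) =
    w^T *m (Delta *m invmx M *m Delta^T) *m w - w^T *m Delta *m u
    - u^T *m Delta^T *m w + u^T *m M *m u.
  move=> symM uM; rewrite [(_ - _)^T]linearB/= !trmx_mul trmxK symM.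
  rewrite !mulmxBl !mulmxBr !mulmxA !(mulmxK uM) !(mulmxKV uM) opprB.
  by rewrite addrA addrAC.
have e3 : u^T *m S *m u = u^T *m u - u^T *m (Delta^T *m Delta) *m u.
  by rewrite /S mulmxBr mulmxBl mulmx1.
have e4 : v^T *m Q *m v = v^T *m v + v^T *m (Delta *m K *m Delta^T) *m v.
  by rewrite /Q /posterior_precision mulmxDr mulmxDl mulmx1.
have addE (A B : 'M[R]_1) : (A + B) 0 0 = A 0 0 + B 0 0 by rewrite mxE.
have oppE (A : 'M[R]_1) : (- A) 0 0 = - A 0 0 by rewrite mxE.
by rewrite /sqn e1 (e2 _ _ symS uS) e3 e4 !(addE, oppE); ring.
Qed.

End complete_the_square.

(** * Stochastic representation *)
Section stochastic_representation.
Context (R : realType).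

(** Sum over the rows of L of the one-row case. *)
Lemma has_integral_sqn_affine p n w c (v : 'cV[R]_p) (L : 'M[R]_(p, n)) :
  unit_weight w c ->
  has_integral (lebesgue_vec R n)
    (fun x => sqn (v + L *m colv x) * \prod_i w (tnth x i))
    (sqn (v + c *: (L *m const_mx 1)) + (1 - c ^+ 2) * \tr (L *m L^T)).
Proof.
move=> wc.
have H k := @has_integral_sqr_affine R n w c (v k 0) (L k) wc.
have -> : sqn (v + c *: (L *m const_mx 1)) + (1 - c ^+ 2) * \tr (L *m L^T) =
    \sum_k ((v k 0 + c * \sum_i L k i) ^+ 2
            + (1 - c ^+ 2) * \sum_i L k i ^+ 2).
  rewrite sqnE /mxtrace mulr_sumr -big_split/=; apply: eq_bigr => k _.
  rewrite !mxE; congr ((_ + _ * _) ^+ 2 + _ * _).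
    by apply: eq_bigr => i _; rewrite mxE mulr1.
  by apply: eq_bigr => i _; rewrite mxE expr2.
apply: eq_has_integral (has_integral_sum H) => x.
rewrite sqnE mulr_suml; apply: eq_bigr => k _; congr (_ ^+ 2 * _).
by rewrite !mxE; congr (_ + _); apply: eq_bigr => i _; rewrite mxE.
Qed.

(** A real-valued indicator, so that the indicator of an orthant is a product
    over the coordinates. *)
Definition nonneg_ind (t : R) : R := if 0 <= t then 1 else 0.

Lemma half_normal_pdfE t :
  half_normal_pdf t = 2 * (nonneg_ind t * normal_pdf 0 1 t).
Proof.
by rewrite /half_normal_pdf /nonneg_ind; case: ifP; rewrite ?mul1r// mul0r mulr0.
Qed.

Lemma prod_half_normal_pdf n (t : 'I_n -> R) :
  \prod_i half_normal_pdf (t i) =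
  2 ^+ n * (\prod_i nonneg_ind (t i) * \prod_i normal_pdf 0 1 (t i)).
Proof.
under eq_bigr do rewrite half_normal_pdfE.
by rewrite 2!big_split/= prodr_const card_ord.
Qed.

Lemma measurable_nonneg_ind : measurable_fun [set: R] nonneg_ind.
Proof. by apply: measurable_fun_ifT => //; exact: measurable_fun_ler. Qed.

Lemma nonneg_ind_ge0 t : 0 <= nonneg_ind t.
Proof. by rewrite /nonneg_ind; case: ifP. Qed.

Lemma prod_nonneg_ind n (t : 'I_n -> R) :
  \prod_i nonneg_ind (t i) = if [forall i, 0 <= t i] then 1 else 0.
Proof.
case: ifPn => [/forallP h|/forallPn[i /negbTE h]].
  by rewrite big1// => i _; rewrite /nonneg_ind h.
by rewrite (bigD1 i)//= {1}/nonneg_ind h mul0r.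
Qed.

Lemma det_opp1_norm n : `|\det (- 1%:M : 'M[R]_n)| = 1.
Proof. by rewrite -raddfN det_scalar normrX normrN1 expr1n. Qed.

Section Phi.
Variables (m : nat) (S : 'M[R]_m) (pS : posdef S).

Lemma integrable_mvnormal_pdf :
  (lebesgue_vec R m).-integrable setT
    (fun y => (mvnormal_pdf S (colv y))%:E).
Proof.
have [] // := @has_integral_ge0 _ _ _ (lebesgue_vec R m)
  (fun y => mvnormal_pdf S (colv y)) 1 (measurable_mvnormal_pdf S).
  by move=> x; exact: mvnormal_pdf_ge0.
exact: integral_mvnormal_pdf.
Qed.

Let lower_set (x : 'cV[R]_m) : set (Rvec R m) :=
  [set y | forall i, colv y i 0 <= x i 0].

Let measurable_lower_set x : measurable (lower_set x).
Proof.
have -> : lower_set x = \bigcap_(i in [set: 'I_m])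
    (fun y => colv y i 0) @^-1` `]-oo, x i 0].
  apply/seteqP; split => y h i; first by move=> _; rewrite /= in_itv/= h.
  by have := h i I; rewrite /= in_itv.
apply: fin_bigcap_measurable => // i _; rewrite -[X in measurable X]setTI.
exact: measurable_colv.
Qed.

Lemma Phi_lower x :
  ((Phi x S)%:E = \int[lebesgue_vec R m]_(y in lower_set x)
    (mvnormal_pdf S (colv y))%:E)%E.
Proof.
rewrite /Phi /Rintegral fineK//.
apply: (integrable_fin_num (measurable_lower_set x)).
exact: (integrableS _ _ _ integrable_mvnormal_pdf).
Qed.

Lemma Phi_ge0 x : 0 <= Phi x S.
Proof. by apply: Rintegral_ge0 => y _; exact: mvnormal_pdf_ge0. Qed.

Lemma Phi_le1 x : Phi x S <= 1.
Proof.
rewrite -lee_fin Phi_lower -(integral_mvnormal_pdf pS).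
apply: ge0_subset_integral => //.
  exact: measurable_int integrable_mvnormal_pdf.
by move=> y _; rewrite lee_fin mvnormal_pdf_ge0.
Qed.

Lemma measurable_orthant_mvnormal_pdf x : measurable_fun [set: Rvec R m]
  (fun u => (\prod_i nonneg_ind (tnth u i)) * mvnormal_pdf S (x - colv u)).
Proof.
apply: measurable_funM.
  exact: (@measurable_tnth_prod R m (fun=> nonneg_ind)
    (fun=> measurable_nonneg_ind)).
have -> : (fun u : Rvec R m => mvnormal_pdf S (x - colv u)) =
    (fun u => mvnormal_pdf S (colv u)) \o affine x (- 1%:M).
  by apply/funext => u; rewrite /= colv_affine mulNmx mul1mx.
apply: (measurableT_comp (measurable_mvnormal_pdf S)).
exact: measurable_affine.
Qed.

Lemma orthant_mvnormal_pdf_ge0 x (u : Rvec R m) :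
  0 <= (\prod_i nonneg_ind (tnth u i)) * mvnormal_pdf S (x - colv u).
Proof.
rewrite mulr_ge0 ?mvnormal_pdf_ge0// prodr_ge0// => i _.
exact: nonneg_ind_ge0.
Qed.

(** The distribution function as an integral over an orthant that does not
    depend on x, by the substitution [y = x - u]. *)
Lemma PhiE x : ((Phi x S)%:E = \int[lebesgue_vec R m]_u
  ((\prod_i nonneg_ind (tnth u i)) * mvnormal_pdf S (x - colv u))%:E)%E.
Proof.
pose g (u : Rvec R m) : \bar R :=
  ((\prod_i nonneg_ind (tnth u i)) * mvnormal_pdf S (x - colv u))%:E.
have mg : measurable_fun [set: Rvec R m] g.
  by apply/measurable_EFinP; exact: measurable_orthant_mvnormal_pdf.
have g0 u : (0 <= g u)%E by rewrite lee_fin orthant_mvnormal_pdf_ge0.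
have := @affine_substitutionN1 R m x g mg g0.
rewrite det_opp1_norm invr1 mul1e => <-.
rewrite Phi_lower integral_mkcond; apply: eq_integral => y _.
rewrite patchE /g colv_affine mulNmx mul1mx opprB addrC subrK.
rewrite prod_nonneg_ind; case: ifPn => [/set_mem yx|yx].
  rewrite ifT ?mul1r//; apply/forallP => i.
  by rewrite tnth_mktuple mulNmx mul1mx !mxE subr_ge0; have := yx i; rewrite mxE.
rewrite ifF ?mul0r//; apply/negbTE; apply: contra yx => /forallP yx.
apply/mem_set => i.
by have := yx i; rewrite tnth_mktuple mulNmx mul1mx !mxE subr_ge0.
Qed.

End Phi.

End stochastic_representation.

Section cfusn_representation.
Context (R : realType) (n m : nat) (Delta : 'M[R]_(n, m)).
Let S : 'M[R]_m := 1%:M - Delta^T *m Delta.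
Hypothesis pS : posdef S.
Variable B : 'M[R]_n.
Hypotheses (QB : posterior_precision Delta = B^T *m B) (uB : B \in unitmx)
  (sB : affine_substitution B).

Let W (u : Rvec R m) : R := \prod_i half_normal_pdf (tnth u i).

Let W_ge0 u : 0 <= W u.
Proof.
apply: prodr_ge0 => i _; rewrite half_normal_pdfE !mulr_ge0//.
  exact: nonneg_ind_ge0.
exact: normal_pdf_ge0.
Qed.

Let measurable_W : measurable_fun [set: Rvec R m] W.
Proof.
apply: (@measurable_tnth_prod R m (fun=> (@half_normal_pdf R))) => _.
by have [/measurable_int/measurable_EFinP] :=
  @unit_weight_half_normal R 0%N isT; under eq_fun do rewrite expr0 mul1r.
Qed.

(** The joint density of Z and [U = Delta^T Z - Y], factored as the law of Z
    given U times the law of U.  With [B^T B] the posterior precision, B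
    standardizes [Z - Delta U], and [`|\det B|] is the Jacobian. *)
Lemma phi_mul_mvnormal_pdf (z : 'cV[R]_n) (u : 'cV[R]_m) :
  phi z * mvnormal_pdf S (Delta^T *m z - u) =
  `|\det B| * phi (B *m (z - Delta *m u)) * phi u.
Proof.
have dS := posdef_det_gt0 pS.
have detB : `|\det B| = (Num.sqrt (\det S))^-1.
  rewrite -sqrtr_sqr expr2 -{1}(det_tr B) -det_mulmx -QB.
  by rewrite det_posterior_precision// sqrtrV// ltW.
have pi2 : 0 <= (2 * pi : R) by rewrite mulr_ge0// pi_ge0.
rewrite !phiE /mvnormal_pdf (sqrtrM (\det S)) ?exprn_ge0// invfM.
have E := complete_the_square pS z u; rewrite -/S in E.
rewrite QB -sqn_mulmx in E.
set a := (Num.sqrt (_ ^+ n))^-1; set b := (Num.sqrt (_ ^+ m))^-1.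
set e1 := expR _; set e2 := expR _; set e3 := expR _; set e4 := expR _.
have e1234 : e1 * e2 = e3 * e4.
  by rewrite -!expRD; congr expR; rewrite -!mulrDl -!opprD E.
transitivity (a * b * (Num.sqrt (\det S))^-1 * (e1 * e2)); first by ring.
by rewrite e1234 detB; ring.
Qed.

Lemma cfusn_pdfE (z : 'cV[R]_n) : ((cfusn_pdf Delta z)%:E =
  \int[lebesgue_vec R m]_u
    (`|\det B| * phi (B *m (z - Delta *m colv u)) * W u)%:E)%E.
Proof.
have phi0 := ltW (phi_gt0 z).
rewrite /cfusn_pdf EFinM PhiE// -ge0_integralZl//.
- apply: eq_integral => u _; rewrite -EFinM; congr EFin.
  rewrite /W prod_half_normal_pdf.
  have := phi_mul_mvnormal_pdf z (colv u).
  rewrite (phi_prod (colv u)); under [in RHS]eq_bigr do rewrite mxE.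
  set p := \prod_i normal_pdf _ _ _; set q := \prod_i nonneg_ind _ => E.
  transitivity (2 ^+ m * q * (phi z * mvnormal_pdf S (Delta^T *m z - colv u))).
    by ring.
  by rewrite E; ring.
- by apply/measurable_EFinP; exact: measurable_orthant_mvnormal_pdf.
- by move=> u _; rewrite lee_fin orthant_mvnormal_pdf_ge0.
- by rewrite lee_fin mulr_ge0// exprn_ge0.
Qed.

Let measurable_kernel : measurable_fun [set: (Rvec R n * Rvec R m)%type]
  (fun p => `|\det B| * phi (B *m (colv p.1 - Delta *m colv p.2)) * W p.2).
Proof.
apply: measurable_funM; last exact: (measurableT_comp measurable_W).
apply: measurable_funM => //; under eq_fun do rewrite phi_prod.
apply: measurable_prod => i _; apply: (measurableT_comp (measurable_normal_pdf _ _)).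
under eq_fun do rewrite mulmxBr mulmxA mxE [X in _ + X]mxE.
have mB := measurableT_comp (@measurable_affine_coord R n n 0 B i)
  (@measurable_fst _ _ (Rvec R n) (Rvec R m)).
have mBD := measurableT_comp (@measurable_affine_coord R n m 0 (B *m Delta) i)
  (@measurable_snd _ _ (Rvec R n) (Rvec R m)).
apply: measurable_funB; [move: mB|move: mBD]; rewrite /comp;
  by under eq_fun do rewrite add0r.
Qed.

(** Skew-normal expectations are expectations under [Delta U + B^-1 V], where U
    is half-normal in each coordinate and V is standard normal: the factor 2 ^ m
    of the density is the one that normalizes the restriction of the law of U to
    the positive orthant. *)
Lemma ge0_integral_cfusn (h : Rvec R n -> \bar R) :
  measurable_fun [set: Rvec R n] h -> (forall z, 0 <= h z)%E ->
  (\int[lebesgue_vec R n]_z (h z * (cfusn_pdf Delta (colv z))%:E) =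
   \int[lebesgue_vec R m]_u ((W u)%:E * \int[lebesgue_vec R n]_w
     (h (affine (Delta *m colv u) (invmx B) w) * (phi (colv w))%:E)))%E.
Proof.
move=> mh h0.
pose k (p : (Rvec R n * Rvec R m)%type) : \bar R :=
  (h p.1 * (`|\det B| * phi (B *m (colv p.1 - Delta *m colv p.2)) * W p.2)%:E)%E.
have kern0 (p : (Rvec R n * Rvec R m)%type) :
    0 <= `|\det B| * phi (B *m (colv p.1 - Delta *m colv p.2)) * W p.2.
  by rewrite !mulr_ge0// ltW// phi_gt0.
have mk : measurable_fun [set: (Rvec R n * Rvec R m)%type] k.
  apply: emeasurable_funM; first exact: (measurableT_comp mh).
  exact/measurable_EFinP.
have k0 p : (0 <= k p)%E by rewrite mule_ge0// lee_fin.
transitivity (\int[lebesgue_vec R n]_z \int[lebesgue_vec R m]_u k (z, u))%E.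
  apply: eq_integral => z _; rewrite cfusn_pdfE -ge0_integralZl//.
  - apply/measurable_EFinP.
    exact: (measurableT_comp measurable_kernel (measurable_pair1 z)).
  - by move=> u _; rewrite lee_fin; exact: (kern0 (z, u)).
rewrite fubini_tonelli//; apply: eq_integral => u _.
pose f (w : Rvec R n) : \bar R :=
  (h (affine (Delta *m colv u) (invmx B) w) * (phi (colv w))%:E)%E.
have mf : measurable_fun [set: Rvec R n] f.
  apply: emeasurable_funM.
    by apply: (measurableT_comp mh); exact: measurable_affine.
  by apply/measurable_EFinP; exact: measurable_mvnormal_pdf.
have f0 w : (0 <= f w)%E by rewrite mule_ge0// lee_fin ltW// phi_gt0.
have dB : `|\det B| != 0 by rewrite normr_eq0 -unitfE -unitmxE.
have := sB (- (B *m (Delta *m colv u))) mf f0.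
move=> /(congr1 (fun x => (W u * `|\det B|)%:E * x)%E).
rewrite [X in _ = X -> _]muleA -[X in _ = (X * _)%E -> _]EFinM mulfK// => <-.
rewrite -ge0_integralZl//.
- apply: eq_integral => z _; rewrite /k /f/=.
  have -> : affine (Delta *m colv u) (invmx B)
      (affine (- (B *m (Delta *m colv u))) B z) = z.
    apply: colv_inj; rewrite !colv_affine mulmxDr mulmxN !mulKmx//.
    by rewrite addrA subrr add0r.
  rewrite colv_affine [- _ + _]addrC -mulmxBr muleCA -EFinM; congr (_ * _%:E)%E.
  by ring.
- by apply: (measurableT_comp mf); exact: measurable_affine.
- by rewrite lee_fin mulr_ge0.
Qed.

End cfusn_representation.

(** * Densities and entropy *)
Section has_integral_ae.
Context d (T : measurableType d) (R : realType).
Variable mu : {measure set T -> \bar R}.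

Lemma ae_has_integral (f g : T -> R) r : measurable_fun setT g ->
  {ae mu, forall x, f x = g x} -> has_integral mu f r -> has_integral mu g r.
Proof.
move=> mg fg [/integrableP[mf foo] fr].
have mg' : measurable_fun setT (EFin \o g) by exact/measurable_EFinP.
have efg : ae_eq mu setT (EFin \o f) (EFin \o g).
  by apply: filterS fg => x fgx _; rewrite /= fgx.
split; last by rewrite -fr; apply/esym; exact: ae_eq_integral.
apply/integrableP; split => //; apply: le_lt_trans foo.
rewrite le_eqVlt; apply/orP; left; apply/eqP/esym.
apply: ae_eq_integral => //; [exact: measurableT_comp|exact: measurableT_comp|].
exact: ae_eq_abse efg.
Qed.

End has_integral_ae.

Lemma has_integral_cst d (T : measurableType d) (R : realType)
    (P : probability T R) (k : R) : has_integral P (cst k) k.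
Proof.
split; first exact: finite_measure_integrable_cst.
by have := expectation_cst P k; rewrite unlock.
Qed.

Section density.
Context (R : realType) (n : nat) (d : measure_display) (T : measurableType d).
Variables (P : probability T R) (X : {RV P >-> Rvec R n}).
Implicit Types f : Rvec R n -> R.
Local Notation lambda := (lebesgue_vec R n).

Lemma density_integrable f : has_density X f ->
  lambda.-integrable setT (EFin \o f).
Proof.
move=> [mf f0 fX]; have [] // := @has_integral_ge0 _ _ _ lambda f 1 mf f0.
by rewrite -fX// probability_setT.
Qed.

(** Two densities have the same integral over every measurable set. *)
Lemma density_ae_eq f g : has_density X f -> has_density X g ->
  ae_eq lambda setT (EFin \o f) (EFin \o g).
Proof.
move=> df dg; have [mf f0 fX] := df; have [mg g0 gX] := dg.
apply: integral_ae_eq => //.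
- exact: density_integrable.
- exact/measurable_EFinP.
- by move=> E _ mE; rewrite -fX// -gX.
Qed.

Lemma density_dominates f : has_density X f -> distribution P X `<< lambda.
Proof.
move=> [mf f0 fX]; apply/null_content_dominatesP => A mA A0.
rewrite fX// null_set_integral//.
exact/measurable_EFinP/measurable_funTS.
Qed.

Lemma ae_density f (Q : Rvec R n -> Prop) : has_density X f ->
  {ae lambda, forall x, Q x} -> {ae P, forall w, Q (X w)}.
Proof.
move=> df [N [mN N0 QN]].
have /null_content_dominatesP dom := density_dominates df.
exists (X @^-1` N); split.
- by rewrite -[X in measurable X]setTI; exact: measurable_funPT.
- exact: dom.
- by move=> w nQ; exact: QN.
Qed.

(** The set where f vanishes has probability the integral of f over it. *)
Lemma density_gt0 f : has_density X f -> {ae P, forall w, 0 < f (X w)}.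
Proof.
move=> [mf f0 fX]; exists (X @^-1` (f @^-1` [set 0])).
have mf0 : measurable (f @^-1` [set 0]).
  by rewrite -[X in measurable X]setTI; exact: mf.
split.
- by rewrite -[X in measurable X]setTI; exact: measurable_funPT.
- have := fX _ mf0; rewrite /distribution /pushforward => ->.
  by rewrite integral0_eq// => x /= ->.
- move=> w /= /negP; rewrite -leNgt => fw.
  by apply/eqP; rewrite eq_le fw f0.
Qed.

(** f is a version of the Radon-Nikodym derivative of the law of X. *)
Lemma ge0_integral_density f (h : Rvec R n -> \bar R) : has_density X f ->
  measurable_fun [set: Rvec R n] h -> (forall x, 0 <= h x)%E ->
  (\int[P]_w h (X w) = \int[lambda]_x (h x * (f x)%:E))%E.
Proof.
move=> df mh h0; have [mf f0 fX] := df; have dom := density_dominates df.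
have -> : (\int[P]_w h (X w) = \int[distribution P X]_x h x)%E.
  by rewrite ge0_integral_distribution.
have intRN := Radon_Nikodym_SigmaFinite.f_integrable dom.
rewrite -(Radon_Nikodym_SigmaFinite.change_of_variables dom h0)//.
apply: ae_eq_integral => //.
- by apply: emeasurable_funM => //; exact: measurable_int intRN.
- by apply: emeasurable_funM => //; exact/measurable_EFinP.
- apply: ae_eqe_mul2l; apply: integral_ae_eq => //.
    exact/measurable_EFinP.
  by move=> E _ mE; rewrite -Radon_Nikodym_SigmaFinite.f_integral// -fX.
Qed.

(** One version of the density suffices, as the others agree with it almost
    surely along X. *)
Lemma is_entropy_density f h : has_density X f ->
  has_integral P (fun w => - ln (f (X w))) h -> is_entropy X h.
Proof.
move=> df Xh; split; first by exists f.
move=> g dg; have [mg _ _] := dg.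
have mX : measurable_fun setT X by exact: measurable_funPT.
have {}Xh : has_integral P (fun w => ln (g (X w))) (- h).
  apply: ae_has_integral (has_integralN Xh).
    apply: measurableT_comp; first exact: measurable_ln.
    exact: (measurableT_comp mg).
  apply: (ae_density (Q := fun x => - - ln (f x) = ln (g x)) df).
  by apply: filterS (density_ae_eq df dg) => x /(_ I)[->]; rewrite opprK.
by split; [exact: Xh.1|rewrite unlock Xh.2 -EFinN opprK].
Qed.

End density.

(** From [ln s < s], at [s = t^-1] if [t < 1] and at [s = t] otherwise.  It makes
    the logarithm of a bounded factor t integrable against t. *)
Lemma normr_lnM_le (R : realType) (t : R) : 0 <= t -> `|ln t| * t <= 1 + t ^+ 2.
Proof.
rewrite le_eqVlt => /predU1P[<-|t0]; first by rewrite mulr0 expr0n addr0.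
have [t1|t1] := ltP t 1.
  rewrite ler0_norm; last by rewrite ln_le0// ltW.
  rewrite -lnV//.
  apply: (@le_trans _ _ 1); last by rewrite lerDl sqr_ge0.
  rewrite -(mulVf (lt0r_neq0 t0)) ler_wpM2r ?(ltW t0)//.
  by rewrite ltW// ln_sublinear// invr_gt0.
rewrite ger0_norm ?ln_ge0// expr2 (@le_trans _ _ (t * t))// ?lerDr//.
by apply: ler_wpM2r; [exact: ltW|apply: ltW; exact: ln_sublinear].
Qed.

(** * The entropy of the skew-normal law *)
Section cfusn.
Context (R : realType) (n m : nat) (Delta : 'M[R]_(n, m)).
Hypothesis skew : skewness_matrix Delta.
Let S : 'M[R]_m := 1%:M - Delta^T *m Delta.
Let pS : posdef S. Proof. exact: skewness_matrix_posdef. Qed.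

Definition cfusn_sqn_mean : R :=
  n%:R + 2 / pi * (sqn (Delta *m const_mx 1) - \tr (Delta *m Delta^T)).

(** Given U, the expectation of [|Delta U + L V| ^ 2] is
    [|Delta U| ^ 2 + tr (1 - Delta Delta^T)]; the half-normal law of U, of squared
    mean [2 / pi], then gives
    [2 / pi * |Delta 1| ^ 2 + (1 - 2 / pi) * tr (Delta Delta^T)] for the first
    term. *)
Lemma integral_sqn_cfusn :
  (\int[lebesgue_vec R n]_z ((sqn (colv z))%:E * (cfusn_pdf Delta (colv z))%:E)
   = cfusn_sqn_mean%:E)%E.
Proof.
have pQ := posterior_precision_posdef pS.
have [B [QB uB sB _]] := posdef_cholesky pQ.
have msqn : measurable_fun [set: Rvec R n] (fun z => (sqn (colv z))%:E).
  by apply/measurable_EFinP; exact: measurable_sqn.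
rewrite (ge0_integral_cfusn pS QB uB sB msqn); last first.
  by move=> z; rewrite lee_fin sqn_ge0.
have trB : \tr (invmx B *m (invmx B)^T) = n%:R - \tr (Delta *m Delta^T).
  have <- : invmx (posterior_precision Delta) = invmx B *m (invmx B)^T.
    have uBT : B^T \in unitmx by rewrite unitmx_tr.
    apply: (can_inj (mulKmx (posdef_unitmx pQ))); rewrite mulmxV ?posdef_unitmx//.
    by rewrite QB -mulmxA (mulKVmx uB) trmx_inv mulmxV.
  by rewrite posterior_precision_inv// linearB/= mxtrace1.
transitivity (\int[lebesgue_vec R m]_u ((sqn (0 + Delta *m colv u) *
    \prod_i half_normal_pdf (tnth u i) + (n%:R - \tr (Delta *m Delta^T)) *
    \prod_i half_normal_pdf (tnth u i))%:E))%E.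
  apply: eq_integral => u _.
  have [_ sqnu] := has_integral_sqn_affine (Delta *m colv u) (invmx B)
    (@unit_weight_std_normal R).
  rewrite scale0r addr0 expr0n subr0 mul1r trB in sqnu.
  rewrite [X in (_ * X)%E](_ : _ =
    (sqn (Delta *m colv u) + (n%:R - \tr (Delta *m Delta^T)))%:E).
    by rewrite -EFinM add0r mulrDr; congr (_ + _)%:E; exact: mulrC.
  rewrite -sqnu; apply: eq_integral => w _.
  rewrite -EFinM colv_affine phi_prod; congr (_ * _)%:E.
  by apply: eq_bigr => i _; rewrite mxE.
have wh := @unit_weight_half_normal R.
have [_ ->] := has_integralD (has_integral_sqn_affine 0 Delta wh)
  (has_integralZ (n%:R - \tr (Delta *m Delta^T)) (has_integral_weight m wh)).
rewrite add0r sqnZ sqr_sqrtr ?divr_ge0 ?pi_ge0// /cfusn_sqn_mean.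
by congr EFin; ring.
Qed.

Lemma cfusn_pdf_mul (z : 'cV[R]_n) :
  cfusn_pdf Delta z = phi z * (2 ^+ m * Phi (Delta^T *m z) S).
Proof. by rewrite /cfusn_pdf [RHS]mulrA [phi z * _]mulrC. Qed.

Definition ln_skewing (z : Rvec R n) : R :=
  ln (2 ^+ m * Phi (Delta^T *m colv z) S).

Lemma ln_cfusn_pdf (z : Rvec R n) : 0 < cfusn_pdf Delta (colv z) ->
  ln (cfusn_pdf Delta (colv z)) =
  - (n%:R / 2 * ln (2 * pi)) - sqn (colv z) / 2 + ln_skewing z.
Proof.
rewrite cfusn_pdf_mul pmulr_rgt0 ?phi_gt0// => Phi0.
by rewrite lnM ?posrE ?phi_gt0// ln_phi.
Qed.

(** The skewing factor is the quotient of the density by the positive function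
    phi, hence measurable. *)
Lemma measurable_ln_skewing :
  measurable_fun [set: Rvec R n] (fun z => cfusn_pdf Delta (colv z)) ->
  measurable_fun [set: Rvec R n] ln_skewing.
Proof.
move=> mf; apply: measurableT_comp; first exact: measurable_ln.
have -> : (fun z : Rvec R n => 2 ^+ m * Phi (Delta^T *m colv z) S) =
    (fun z => cfusn_pdf Delta (colv z) *
      (Num.sqrt ((2 * pi) ^+ n) * expR (sqn (colv z) / 2))).
  apply/funext => z; rewrite cfusn_pdf_mul [RHS]mulrAC -[LHS]mul1r.
  congr (_ * _); rewrite phiE mulNr expRN mulrACA.
  have k0 : Num.sqrt ((2 * pi : R) ^+ n) != 0.
    by rewrite gt_eqF// sqrtr_gt0 exprn_gt0// mulr_gt0// pi_gt0.
  by rewrite mulVf// mulVf ?mulr1// gt_eqF// expR_gt0.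
apply: measurable_funM => //; apply: measurable_funM => //.
apply: measurableT_comp => //; apply: measurable_funM => //.
exact: measurable_sqn.
Qed.

Section random_vector.
Context (d : measure_display) (T : measurableType d) (P : probability T R).
Variable Z : {RV P >-> Rvec R n}.
Hypothesis dZ : is_cfusn Z Delta.

Lemma has_integral_sqn_cfusn :
  has_integral P (fun w => sqn (colv (Z w))) cfusn_sqn_mean.
Proof.
have msqn := @measurable_sqn R n.
apply: has_integral_ge0.
- apply: (measurableT_comp msqn); exact: measurable_funPT.
- by move=> w; exact: sqn_ge0.
- rewrite (ge0_integral_density (h := fun z => (sqn (colv z))%:E) dZ).
  + exact: integral_sqn_cfusn.
  + exact/measurable_EFinP.
  + by move=> z; rewrite lee_fin sqn_ge0.
Qed.

(** With t the skewing factor, which is at most 2 ^ m, the integrand is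
    [phi * (|ln t| * t)], at most [(1 + (2 ^ m) ^ 2) * phi]. *)
Lemma integrable_ln_skewing :
  P.-integrable setT (EFin \o (fun w => ln_skewing (Z w))).
Proof.
have [mf f0 _] := dZ; have mln := measurable_ln_skewing mf.
apply/integrableP; split.
  by apply/measurable_EFinP/(measurableT_comp mln); exact: measurable_funPT.
rewrite (ge0_integral_density (h := fun z => `|(ln_skewing z)%:E|%E) dZ)//;
  last by apply: measurableT_comp => //; exact/measurable_EFinP.
apply: (@le_lt_trans _ _ (\int[lebesgue_vec R n]_z
    ((1 + (2 ^+ m) ^+ 2)%:E * (phi (colv z))%:E)))%E.
  apply: ge0_le_integral => //.
  - by move=> z _; rewrite mule_ge0// lee_fin.
  - apply: emeasurable_funM; last exact/measurable_EFinP.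
    by apply: measurableT_comp => //; exact/measurable_EFinP.
  - apply: emeasurable_funM => //.
    by apply/measurable_EFinP; exact: measurable_mvnormal_pdf.
  - move=> z _; rewrite -EFinM lee_fin cfusn_pdf_mul mulrCA [leRHS]mulrC.
    apply: ler_wpM2l; first by rewrite ltW// phi_gt0.
    have Phi0 := Phi_ge0 S (Delta^T *m colv z).
    have Phi1 := Phi_le1 pS (Delta^T *m colv z).
    apply: le_trans (normr_lnM_le _) _; first by rewrite mulr_ge0// exprn_ge0.
    by rewrite lerD2l lerXn2r ?nnegrE ?mulr_ge0 ?exprn_ge0// ler_piMr ?exprn_ge0.
rewrite ge0_integralZl//.
- by rewrite integral_phi mule1 ltry.
- by apply/measurable_EFinP; exact: measurable_mvnormal_pdf.
- by move=> z _; rewrite lee_fin ltW// phi_gt0.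
Qed.

End random_vector.

End cfusn.

(** The probability of E is the integral of f over the preimage of E; as A has an
    inverse, its integrand is a function of [c + A x] to which the substitution
    applies. *)
Lemma has_density_affine (R : realType) (n : nat) (d : measure_display)
    (T : measurableType d) (P : probability T R) (X Z : {RV P >-> Rvec R n})
    (c : 'cV[R]_n) (A : 'M[R]_n) (f : Rvec R n -> R) :
  affine_substitution A -> A \in unitmx -> has_density Z f ->
  (forall w, X w = affine c A (Z w)) ->
  has_density X
    (fun x => `|\det A|^-1 * f (affine (- (invmx A *m c)) (invmx A) x)).
Proof.
move=> sA uA [mf f0 fZ] XZ.
pose iaff : Rvec R n -> Rvec R n := affine (- (invmx A *m c)) (invmx A).
have iaffK x : iaff (affine c A x) = x.
  exact: affineK.
have miaff : measurable_fun [set: Rvec R n] iaff by exact: measurable_affine.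
have maff := @measurable_affine R n n c A.
have mg : measurable_fun [set: Rvec R n] (fun x => `|\det A|^-1 * f (iaff x)).
  by apply: measurable_funM => //; exact: (measurableT_comp mf).
have g0 x : 0 <= `|\det A|^-1 * f (iaff x) by rewrite mulr_ge0// invr_ge0.
have dA : `|\det A| != 0 by rewrite normr_eq0 -unitfE -unitmxE.
split => // E mE.
pose F (x : Rvec R n) : \bar R :=
  ((fun x => (`|\det A|^-1 * f (iaff x))%:E) \_ E) x.
have mF : measurable_fun [set: Rvec R n] F.
  apply/(measurable_restrictT _ mE)/measurable_funTS.
  exact/measurable_EFinP.
have F0 x : (0 <= F x)%E.
  by rewrite /F patchE; case: ifP => // _; rewrite lee_fin.
have mEA : measurable (affine c A @^-1` E).
  by rewrite -[X in measurable X]setTI; exact: maff.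
have -> : distribution P X E = distribution P Z (affine c A @^-1` E).
  rewrite /distribution /pushforward; congr (P _).
  by apply/seteqP; split => w /=; rewrite XZ.
rewrite [RHS]integral_mkcond -/F fZ//.
have := sA c F mF F0 => /(congr1 (fun x => `|\det A|%:E * x)%E).
rewrite muleA -EFinM mulfV// mul1e => <-.
rewrite -ge0_integralZl//; last by apply: (measurableT_comp mF).
rewrite [LHS]integral_mkcond; apply: eq_integral => x _.
rewrite /F !patchE iaffK.
have -> : (affine c A x \in E) = (x \in affine c A @^-1` E) by [].
by case: ifP => _; rewrite ?mule0// -EFinM mulrA mulfV// mul1r.
Qed.

Lemma is_entropy_std_normal (R : realType) (n : nat) (d : measure_display)
    (T : measurableType d) (P : probability T R) (Y : {RV P >-> Rvec R n}) :
  is_std_normal Y -> is_entropy Y (n%:R / 2 * (1 + ln (2 * pi))).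
Proof.
move=> dY; apply: (is_entropy_density dY).
have msqn := @measurable_sqn R n.
have sqnY : has_integral P (fun w => sqn (colv (Y w))) n%:R.
  apply: has_integral_ge0.
  - apply: (measurableT_comp msqn); exact: measurable_funPT.
  - by move=> w; exact: sqn_ge0.
  rewrite (ge0_integral_density (h := fun y => (sqn (colv y))%:E) dY).
  - have [_] := has_integral_sqn_affine (0 : 'cV[R]_n) 1%:M
      (@unit_weight_std_normal R).
    rewrite scale0r addr0 expr0n subr0 mul1r trmx1 mulmx1 mxtrace1.
    rewrite [sqn 0]/sqn mulmx0 mxE add0r => <-; apply: eq_integral => y _.
    rewrite -EFinM add0r mul1mx phi_prod; congr (_ * _)%:E.
    by apply: eq_bigr => i _; rewrite mxE.
  - exact/measurable_EFinP.
  - by move=> y; rewrite lee_fin sqn_ge0.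
have -> : n%:R / 2 * (1 + ln (2 * pi)) =
    2^-1 * n%:R + n%:R / 2 * ln (2 * pi) :> R by rewrite mulrDr mulr1 mulrC.
apply: eq_has_integral
  (has_integralD (has_integralZ 2^-1 sqnY) (has_integral_cst P _)) => w.
by rewrite ln_phi -opprD opprK addrC; congr (_ + _); exact: mulrC.
Qed.

Theorem proposition2 (R : realType) (n m : nat) (hn : (0 < n)%N) (hm : (0 < m)%N)
    (mu : 'cV[R]_n) (Sigma : 'M[R]_n) (Delta : 'M[R]_(n, m))
    (hSigma : posdef Sigma) (hDelta : skewness_matrix Delta)
    (d : measure_display) (T : measurableType d) (P : probability T R)
    (X : {RV P >-> Rvec R n}) (hX : is_cfusn_ls X mu Sigma Delta)
    (d0 : measure_display) (T0 : measurableType d0) (P0 : probability T0 R)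
    (X0 : {RV P0 >-> Rvec R n}) (hX0 : is_cfusn X0 Delta)
    (d1 : measure_display) (T1 : measurableType d1) (P1 : probability T1 R)
    (Y : {RV P1 >-> Rvec R n}) (hY : is_std_normal Y) :
  let H_N : R := n%:R / 2 * (1 + ln (2 * pi)) in
  let ones : 'cV[R]_m := const_mx 1 in
  let Delta_star := 1%:M - Delta^T *m Delta in
  let g := fun w : T0 =>
    ln (2 ^+ m * Phi (Delta^T *m colv (X0 w)) Delta_star) in
  [/\ is_entropy Y H_N,
      P0.-integrable [set: T0] (EFin \o g) &
      is_entropy X
        (H_N + ln (\det Sigma) / 2
         + pi^-1 * ((ones^T *m Delta^T *m Delta *m ones) 0 0
                    - \tr (Delta *m Delta^T))
         - fine 'E_P0[g])].
Proof.
move=> H_N ones Delta_star g.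
have intg : P0.-integrable setT (EFin \o g) := integrable_ln_skewing hDelta hX0.
split; [exact: is_entropy_std_normal|exact: intg|].
have [S [Z [pS SS hZ XZ]]] := hX.
have intgZ := integrable_ln_skewing hDelta hZ.
have [mf f0 fZ] := hZ; have [_ _ fX0] := hX0.
have mln := measurable_ln_skewing mf.
(* Z and X0 have the same law, although they live on different spaces *)
have gZ : has_integral P (fun w => ln_skewing Delta (Z w)) (fine 'E_P0[g]).
  split => //.
  have mE : measurable_fun [set: Rvec R n] (EFin \o ln_skewing Delta).
    exact/measurable_EFinP.
  rewrite unlock fineK; last exact: integrable_fin_num intg.
  rewrite -(@integral_distribution _ _ _ _ _ P Z _ mE intgZ).
  rewrite -[RHS](@integral_distribution _ _ _ _ _ P0 X0 _ mE intg).
  by apply: eq_measure_integral => A mA _; rewrite [LHS]fZ// [RHS]fX0.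
have detS := posdef_det_gt0 pS; have uS := posdef_unitmx pS.
have XZ' w : X w = affine mu S (Z w).
  by apply: colv_inj; rewrite colv_affine XZ.
have dX := has_density_affine (posdef_affine_substitution pS) uS hZ XZ'.
apply: (is_entropy_density dX).
have [mg _ _] := dX.
have -> : H_N + ln (\det Sigma) / 2 + pi^-1 *
      ((ones^T *m Delta^T *m Delta *m ones) 0 0 - \tr (Delta *m Delta^T))
      - fine 'E_P0[g] =
    2^-1 * cfusn_sqn_mean Delta + (- fine 'E_P0[g]) +
    (n%:R / 2 * ln (2 * pi) + ln (\det S)).
  rewrite -SS det_mulmx [ln (\det S * _)]lnM ?posrE//.
  rewrite /cfusn_sqn_mean sqn_mulmx /H_N !mulmxA.
  by set ip := pi^-1; set l := ln (2 * pi); field.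
apply: ae_has_integral (has_integralD (has_integralD
  (has_integralZ 2^-1 (has_integral_sqn_cfusn hDelta hZ)) (has_integralN gZ))
  (has_integral_cst P _)).
  apply: measurableT_comp => //; apply: measurableT_comp => //.
  exact: (measurableT_comp mg).
apply: filterS (density_gt0 hZ) => w fZ0.
rewrite XZ' affineK// gtr0_norm//.
rewrite [ln (_ * cfusn_pdf _ _)]lnM ?posrE ?invr_gt0// lnV ?posrE//.
by rewrite ln_cfusn_pdf//; set l := ln (2 * pi); rewrite /cst; field.
Qed.
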